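(* Fix $T\ge1$ and assume that condition $(C_\mu)$ (stated in the context) is satisfied. Let $\overline{h}=(\overline{h}_t)_{1\le t\le T}$ be the unique solution of $$\overline{h}_t=m_t+\sum_{l=1}^{t}A_l\,\overline{\gamma}(t,l)\,(Y_l-A_l\overline{h}_l),\qquad 1\le t\le T,$$ i.e. $\overline{h}$ is the solution of the LEG filtering problem of minimizing $\mathbb{E}\big[\mu\exp\{\frac{\mu}{2}\sum_{t=1}^T(X_t-h_t)^2Q_t\}\big]$ over all $h$ with $h_t$ $\mathcal{Y}_t$-measurable for each $t$. Then $\overline{h}$ is the solution of the risk-sensitive (RS) filtering problem, i.e. for every $1\le t\le T$, $$\overline{h}_t=\operatorname*{argmin}_{g\in\mathcal{Y}_t}\ \mathbb{E}\left[\mu\exp\left\{\frac{\mu}{2}(X_t-g)^2Q_t+\frac{\mu}{2}\sum_{s=1}^{t-1}(X_s-\overline{h}_s)^2Q_s\right\}\Big/\mathcal{Y}_t\right],$$ where $g\in\mathcal{Y}_t$ means that $g$ is a $\mathcal{Y}_t$-measurable random variable (that is, $\overline{h}_t$ almost surely attains the minimum of the conditional expectation over such $g$).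
   Context: Setting: $X=(X_t)_{t\ge1}$ is an arbitrary real Gaussian sequence with mean $m_t=\mathbb{E}X_t$ and covariance $K(t,s)=\mathbb{E}(X_t-m_t)(X_s-m_s)$. The observations are $Y_t=A_tX_t+\varepsilon_t$, $t\ge 1$, where $(A_t)_{t\ge1}$ is a deterministic real sequence and $(\varepsilon_t)_{t\ge1}$ are i.i.d. $\mathcal{N}(0,1)$, independent of $X$. $\mathcal{Y}_t=\sigma(Y_u,\,1\le u\le t)$. $\mu$ is a fixed real number and $(Q_t)_{t\ge1}$ a fixed sequence of nonnegative real numbers. $\mathbb{E}(\cdot/\mathcal{G})$ denotes conditional expectation given $\mathcal{G}$; for $\mu>0$ these (conditional) expectations may take the value $+\infty$. Condition $(C_\mu)$ (for horizon $T$): the equation $$\overline{\gamma}(t,s)=K(t,s)-\sum_{l=1}^{s-1}\overline{\gamma}(t,l)\overline{\gamma}(s,l)\frac{S_l}{1+S_l\overline{\gamma}_l},\qquad S_l=A_l^2-\mu Q_l,\ \overline{\gamma}_l=\overline{\gamma}(l,l),$$ has a unique and bounded solution on $\{(t,s):1\le s\le t\le T\}$, such that $\overline{\gamma}_l\ge0$ and $1+S_l\overline{\gamma}_l>0$ for all $1\le l\le T$. The $\overline{\gamma}$ in the claim is this solution. *)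

(* Defs.v *)
From HB Require Import structures.
From mathcomp Require Import all_boot all_order all_algebra.
From mathcomp Require Import all_classical all_reals all_analysis measurable_realfun.

Set Implicit Arguments.
Unset Strict Implicit.
Unset Printing Implicit Defensive.

Import Order.TTheory GRing.Theory Num.Theory.

Local Open Scope classical_set_scope.
Local Open Scope ring_scope.

(* All sequences are indexed by t >= 1: their value at index 0 is never used. *)

Section Independence.
Context {R : realType} {d : measure_display} {Omega : measurableType d}.
Variable P : probability Omega R.

Definition sigma_of {I : Type} (D : set I) (X : I -> Omega -> R) :
    set (set Omega) :=
  <<s \bigcup_(i in D) preimage_set_system setT (X i) measurable >>.

(* Product rule over every finite subfamily. *)
Definition mutually_independent {I : eqType} (D : set I)
    (X : I -> Omega -> R) : Prop :=
  forall (J : seq I) (B : I -> set R), uniq J -> [set` J] `<=` D ->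
    (forall i, measurable (B i)) ->
    P (\bigcap_(i in [set` J]) (X i @^-1` B i)) =
    (\prod_(i <- J) P (X i @^-1` B i))%E.

Definition independent_classes (F G : set (set Omega)) : Prop :=
  forall A B, F A -> G B -> P (A `&` B) = (P A * P B)%E.

Definition iid_standard_normal {I : eqType} (D : set I)
    (Z : I -> {RV P >-> R}) : Prop :=
  mutually_independent D (fun i => Z i : Omega -> R) /\
  forall i, D i -> forall B : set R, measurable B ->
    distribution P (Z i) B = normal_prob 0 1 B.

End Independence.

(* A random vector is Gaussian if it has the law of an affine image b + L Z of
   a vector Z of i.i.d. N(0, 1) variables, on some probability space. L is
   arbitrary, so the covariance matrix may be singular. *)
Definition gaussian_vector {R : realType} {d : measure_display}
    {Omega : measurableType d} (P : probability Omega R) (n : nat)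
    (X : 'I_n -> {RV P >-> R}) : Prop :=
  exists (d' : measure_display) (Omega' : measurableType d')
         (P' : probability Omega' R) (k : nat) (Z : 'I_k -> {RV P' >-> R})
         (b : 'I_n -> R) (L : 'M[R]_(n, k)),
    iid_standard_normal setT Z /\
    forall B : set (n.-tuple R), measurable B ->
      P [set w | B [tuple X i w | i < n]] =
      P' [set w | B [tuple b i + \sum_(j < k) L i j * Z j w | i < n]].

Definition gaussian_sequence {R : realType} {d : measure_display}
    {Omega : measurableType d} (P : probability Omega R)
    (X : nat -> {RV P >-> R}) : Prop :=
  forall n : nat, gaussian_vector (fun i : 'I_n => X i.+1).

Section Conditioning.
Context {R : realType} {d : measure_display} {Omega : measurableType d}.

Definition measurable_wrt (G : set (set Omega)) {d' : measure_display}
    {T' : measurableType d'} (f : Omega -> T') : Prop :=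
  forall B : set T', measurable B -> G (f @^-1` B).

(* [e] is a version of the conditional expectation of [f] given the
   sigma-algebra [G]. It is used for [f] of constant sign, where the integrals
   always make sense; [e] is extended-real-valued because [f] is not assumed to
   be integrable. *)
Definition is_cond_exp (P : probability Omega R) (G : set (set Omega))
    (f e : Omega -> \bar R) : Prop :=
  measurable_wrt G e /\
  forall A, G A -> (\int[P]_(w in A) e w = \int[P]_(w in A) f w)%E.

End Conditioning.

Section Filtering.
Context {R : realType}.

(* The non-vanishing clause makes every quotient in the equation meaningful. *)
Definition gamma_equation (K : nat -> nat -> R) (S : nat -> R) (T : nat)
    (gam : nat -> nat -> R) : Prop :=
  forall t s : nat, (1 <= s)%N -> (s <= t)%N -> (t <= T)%N ->
    (forall l : nat, (1 <= l < s)%N -> 1 + S l * gam l l != 0) /\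
    gam t s = K t s
      - \sum_(1 <= l < s) gam t l * gam s l * (S l / (1 + S l * gam l l)).

Definition S_coef (A Q : nat -> R) (mu : R) (l : nat) : R :=
  A l ^+ 2 - mu * Q l.

(* Condition (C_mu) for horizon [T], with solution [gam]. *)
Definition condition_C (K : nat -> nat -> R) (A Q : nat -> R) (mu : R)
    (T : nat) (gam : nat -> nat -> R) : Prop :=
  let S := S_coef A Q mu in
  [/\ gamma_equation K S T gam,
      (forall gam', gamma_equation K S T gam' ->
         forall t s : nat, (1 <= s)%N -> (s <= t)%N -> (t <= T)%N ->
           gam' t s = gam t s),
      (exists M : R, forall t s : nat, (1 <= s)%N -> (s <= t)%N -> (t <= T)%N ->
         `|gam t s| <= M) &
      (forall l : nat, (1 <= l <= T)%N ->
         0 <= gam l l /\ 0 < 1 + S l * gam l l)].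

Context {Omega : Type}.

Definition observation (A : nat -> R) (X eps : nat -> Omega -> R) (t : nat)
    (w : Omega) : R :=
  A t * X t w + eps t w.

Definition filter_equation (m A : nat -> R) (gam : nat -> nat -> R)
    (Y : nat -> Omega -> R) (T : nat) (h : nat -> Omega -> R) : Prop :=
  forall (t : nat) (w : Omega), (1 <= t <= T)%N ->
    h t w = m t + \sum_(1 <= l < t.+1) A l * gam t l * (Y l w - A l * h l w).

Definition RS_cost (mu : R) (Q : nat -> R) (X h : nat -> Omega -> R) (t : nat)
    (g : Omega -> R) (w : Omega) : R :=
  mu * expR (mu / 2 * (X t w - g w) ^+ 2 * Q t
             + mu / 2 * \sum_(1 <= s < t) (X s w - h s w) ^+ 2 * Q s).

End Filtering.

(* [h t] is [Y_t]-measurable and almost surely minimises the conditional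
   expectation of the cost over all [Y_t]-measurable [g]. *)
Definition RS_argmin {R : realType} {d : measure_display}
    {Omega : measurableType d} (P : probability Omega R) (mu : R)
    (Q : nat -> R) (X Y h : nat -> Omega -> R) (t : nat) : Prop :=
  let Yt := sigma_of [set u : nat | (1 <= u <= t)%N] Y in
  measurable_wrt Yt (h t) /\
  forall g : Omega -> R, measurable_wrt Yt g ->
  forall eh eg : Omega -> \bar R,
    is_cond_exp P Yt (EFin \o RS_cost mu Q X h t (h t)) eh ->
    is_cond_exp P Yt (EFin \o RS_cost mu Q X h t g) eg ->
    {ae P, forall w, (eh w <= eg w)%E}.

(* Main.v *)
(* Conditionally on the observations the exponential cost stays Gaussian, so the
   minimisation can be done one observation at a time.  Expectations of functions
   of [X] are written as iterated one-dimensional Gaussian integrals along a list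
   of directions, whose covariance is [\sum_l l i * l j].  Girsanov's formula turns
   the noise into a reference Gaussian measure for the observations; then, for a
   fixed value [u] of the [l]-th observation, the likelihood and the [l]-th cost
   together are the exponential of a quadratic polynomial of [X_l] alone.  After a
   rotation making all directions but one vanish at the coordinate [l], this
   factor is absorbed by completing a square in one variable.  The new covariance
   is given by the recursion defining [gam], the condition [1 + S_l gam_l > 0] being
   exactly what completing the square requires, and the new mean is the one
   computed by the filter equation.  After the last observation, [X_t] is thus a
   symmetric Gaussian variable centred at [h_t], up to a factor depending only on
   the observations, and what remains is to minimise
   [mu * E exp (mu / 2 * Q_t * (X_t - g)^2)] over constants [g]. *)

From HB Require Import structures.
Require Import Defs.
From mathcomp Require Import all_boot all_order all_algebra.
From mathcomp Require Import all_classical all_reals all_analysis.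
From mathcomp Require Import measurable_realfun ring lra.

Set Implicit Arguments.
Unset Strict Implicit.
Unset Printing Implicit Defensive.

Import Order.TTheory GRing.Theory Num.Theory.
Import numFieldNormedType.Exports.
Import HBNNSimple.

Local Open Scope classical_set_scope.
Local Open Scope ring_scope.

(** For [mu > 0] the expectations may be infinite, so nothing can be subtracted and no conditional
    law is computed. All Gaussian integrals of costs bear on nonnegative functions, so that
    Tonelli's theorem and monotone convergence always apply; the sign of [mu] is factored out at the
    end. Optimality is reduced to an inequality between integrals over each event of the
    observations. On such an event the costs of [h t] and of a competitor are both functions of the
    state and of the observations, and eliminating one observation multiplies both sides by the same
    factor. The factors never have to be compared: the inequality only has to be checked after the
    last observation, where the competitor has become a constant. This is why the elimination
    carries two arbitrary final integrands. The cost at the current instant depends on the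
    competitor and stays in the final integrand, outside the tilting. Lists of directions replace
    covariance matrices so that singular covariances are covered without any inversion: eliminating
    an observation only rescales one direction. *)

(** * Integration against a measure with a density *)

Section Density.
Context {d : measure_display} {T : measurableType d} {R : realType}.
Variables (mu nu : {measure set T -> \bar R}) (p : T -> R).
Hypotheses (mp : measurable_fun setT p) (p0 : forall x, 0 <= p x).
Hypothesis nuE : forall B, measurable B -> nu B = (\int[mu]_(x in B) (p x)%:E)%E.

Lemma ge0_integral_density (f : T -> \bar R) :
  measurable_fun setT f -> (forall x, 0 <= f x)%E ->
  (\int[nu]_x f x = \int[mu]_x (f x * (p x)%:E))%E.
Proof.
move=> mf f0; pose f_ := nnsfun_approx measurableT mf.
have fE x : f x = limn (EFin \o f_ ^~ x).
  by apply/esym/cvg_lim => //; exact: cvg_nnsfun_approx.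
transitivity (limn (fun n => \int[nu]_x (f_ n x)%:E)%E).
  rewrite -monotone_convergence//.
  - by apply: eq_integral => x _; exact: fE.
  - by move=> n; exact/measurable_EFinP.
  - by move=> n x _; rewrite lee_fin.
  - by move=> x _ m n mn; rewrite lee_fin; exact/lefP/nd_nnsfun_approx.
transitivity (limn (fun n => \int[mu]_x ((f_ n x)%:E * (p x)%:E))%E); last first.
  rewrite -monotone_convergence//.
  - apply: eq_integral => x _; apply/cvg_lim => //.
    by apply: cvgeZr => //; exact: cvg_nnsfun_approx.
  - by move=> n; apply/emeasurable_funM; exact/measurable_EFinP.
  - by move=> n x _; rewrite mule_ge0 ?lee_fin.
  - move=> x _ m n mn; apply: lee_wpmul2r; rewrite ?lee_fin//.
    exact/lefP/nd_nnsfun_approx.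
congr (limn _); apply/funext => n.
rewrite [LHS](_ : _ = \sum_(r \in range (f_ n)) r%:E * nu (f_ n @^-1` [set r]))%E; last first.
  by rewrite integralT_nnsfun sintegralE.
transitivity (\sum_(k \in range (f_ n))
    \int[mu]_x ((k * \1_(f_ n @^-1` [set k]) x)%:E * (p x)%:E))%E; last first.
  rewrite -ge0_integral_fsum//; last 2 first.
  - move=> y; apply: emeasurable_funM; last exact/measurable_EFinP.
    exact/measurable_EFinP/measurable_funM.
  - move=> y x _; apply: mule_ge0; last by rewrite lee_fin.
    by rewrite EFinM nnfun_muleindic_ge0.
  apply: eq_integral => x _.
  rewrite -ge0_mule_fsuml; last by move=> r; rewrite EFinM nnfun_muleindic_ge0.
  by rewrite fsumEFin// -fimfunE.
apply: eq_fsbigr => r; rewrite inE => -[y _ <-{r}].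
rewrite nuE// integral_mkcond -ge0_integralZl//.
- apply: eq_integral => x _; rewrite patchE indicE.
  by case: ifPn => _; rewrite ?mulr1 ?mulr0 ?mul0e ?mule0.
- apply/(measurable_restrictT _ _).1 => //.
  exact/measurable_funTS/measurable_EFinP.
- by move=> x _; rewrite patchE; case: ifP => // _; rewrite lee_fin.
- by rewrite lee_fin.
Qed.

End Density.

(** * One-dimensional Gaussian integrals *)

Section Normal.
Context {R : realType}.
Local Notation leb := (@lebesgue_measure R).
Local Notation N01 := (normal_prob (0 : R) (1 : R)).
Implicit Types (f : R -> \bar R).

Definition phi (x : R) : R := normal_pdf 0 1 x.

Lemma phiE x : phi x = normal_peak 1 * expR (- x ^+ 2 / 2).
Proof.
rewrite /phi normal_pdfE ?oner_eq0// /normal_fun subr0 expr1n.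
by rewrite -[1 *+ 2]/(2%:R).
Qed.

Lemma phi_ge0 x : 0 <= phi x. Proof. exact: normal_pdf_ge0. Qed.

Lemma measurable_phi : measurable_fun setT phi.
Proof. exact: measurable_normal_pdf. Qed.

Lemma ge0_integral_normal f : measurable_fun setT f -> (forall x, 0 <= f x)%E ->
  (\int[N01]_x f x = \int[leb]_x (f x * (phi x)%:E))%E.
Proof.
move=> mf f0; rewrite (@ge0_integral_density _ _ _ leb N01 phi)//.
- exact: measurable_phi.
- exact: phi_ge0.
Qed.

(** Lebesgue measure equals [b] times its image under the affine map, since the two agree on
    half-open intervals; what remains is the change of variables for an image measure. *)
Lemma ge0_integral_affine f (a b : R) : 0 < b ->
  measurable_fun setT f -> (forall x, 0 <= f x)%E ->
  (\int[leb]_x f x = \int[leb]_x (f (a + b * x)%R * b%:E))%E.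
Proof.
move=> b0 mf f0.
have mab : measurable_fun setT (fun x : R => a + b * x : R).
  by apply: measurable_funD => //; exact: measurable_funM.
have bge0 : 0 <= b by exact: ltW.
pose g := (fun x => a + b * x) : R -> measurableTypeR R.
have mg : measurable_fun setT g by [].
have E A : measurable A -> leb A = mscale (NngNum bge0) (pushforward leb g) A.
  move: A; apply: lebesgue_measure_unique => // _ [[c d]] _ <-.
  rewrite /mscale/= /pushforward.
  have gE : g @^-1` `]c, d] = `](c - a) / b, (d - a) / b]%classic.
    apply/seteqP; split => x; rewrite /g/= !in_itv/= ltr_pdivrMr// ler_pdivlMr//.
      by move=> /andP[? ?]; apply/andP; split; lra.
    by move=> /andP[? ?]; apply/andP; split; lra.
  transitivity (b%:E * leb [set` `](c - a) / b, (d - a) / b]%R])%E; last first.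
    by rewrite -gE.
  rewrite !lebesgue_measure_itv/= !lte_fin ltr_pM2r ?invr_gt0// ltrD2r.
  case: ifPn => _; last by rewrite mule0.
  by rewrite -!EFinB -EFinM; congr EFin; field; rewrite gt_eqF.
rewrite (eq_measure_integral (mscale (NngNum bge0) (pushforward leb g))); last first.
  by move=> A mA _; exact: E.
rewrite ge0_integral_mscale//= ge0_integral_pushforward//.
rewrite preimage_setT muleC -ge0_integralZr//.
- exact: measurableT_comp.
- by move=> x _; exact: f0.
Unshelve. all: exact: mg.
Qed.

Lemma ge0_integral_normal_opp f :
  measurable_fun setT f -> (forall x, 0 <= f x)%E ->
  (\int[N01]_x f (- x)%R = \int[N01]_x f x)%E.
Proof.
move=> mf f0.
have mN : measurable_fun setT (fun x : R => - x : R) by exact: measurableT_comp.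
have mg : measurable_fun setT (fun x => f x * (phi x)%:E)%E.
  by apply: emeasurable_funM => //; apply/measurable_EFinP; exact: measurable_phi.
rewrite !ge0_integral_normal//; last exact: measurableT_comp.
pose g := -%R : R -> measurableTypeR R.
have mg' : measurable_fun setT g by [].
have h0 : {in setT, forall y, 0 <= f y * (phi y)%:E}%E.
  by move=> y _; rewrite mule_ge0// lee_fin phi_ge0.
pose leb' : {measure set (measurableTypeR R) -> \bar R} := lebesgue_measure.
have H := @ge0_integral_pushforward _ _ (measurableTypeR R) (measurableTypeR R)
  R g mg' leb' setT _ measurableT mg h0.
transitivity (\int[leb']_(x in g @^-1` setT) (f (g x) * (phi (g x))%:E))%E.
  by rewrite preimage_setT; apply: eq_integral => x _; rewrite /g !phiE sqrrN.
transitivity (\int[pushforward leb' g]_x (f x * (phi x)%:E))%E; first exact/esym.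
by apply: eq_measure_integral => A mA _; exact: lebesgue_measureN.
Qed.

(** Completing the square: adding the Gaussian exponent [- x ^+ 2 / 2] leaves [c + b ^+ 2 / (2 * D)
    - D / 2 * (x - b / D) ^+ 2]. Thus [D] is the precision of the tilted law, which explains the
    coefficient [(1 - D) / 2]. *)
Lemma ge0_integral_normal_tilt (D b c : R) (k : R -> \bar R) : 0 < D ->
  measurable_fun setT k -> (forall x, 0 <= k x)%E ->
  (\int[N01]_x ((expR (c + b * x + (1 - D) / 2 * x ^+ 2))%:E * k x) =
   (expR (c + b ^+ 2 / (2 * D)) / Num.sqrt D)%:E *
     \int[N01]_x k (b / D + (Num.sqrt D)^-1 * x)%R)%E.
Proof.
move=> D0 mk k0.
have s0 : 0 < Num.sqrt D by rewrite sqrtr_gt0.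
have sD : Num.sqrt D ^+ 2 = D by rewrite sqr_sqrtr// ltW.
have mw : measurable_fun setT (fun x : R => expR (c + b * x + (1 - D) / 2 * x ^+ 2)).
  apply: measurableT_comp => //; apply: measurable_funD.
    by apply: measurable_funD => //; exact: measurable_funM.
  by apply: measurable_funM => //; exact: measurable_funX.
have mF : measurable_fun setT (fun x =>
    (expR (c + b * x + (1 - D) / 2 * x ^+ 2))%:E * k x)%E.
  by apply: emeasurable_funM => //; exact/measurable_EFinP.
have mab : measurable_fun setT (fun x : R => b / D + (Num.sqrt D)^-1 * x : R).
  by apply: measurable_funD => //; exact: measurable_funM.
have mphi : measurable_fun setT (fun x => (phi x)%:E).
  apply/measurable_EFinP; exact: measurable_phi.
rewrite ge0_integral_normal//; last by move=> x; rewrite mule_ge0// lee_fin expR_ge0.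
rewrite ge0_integral_normal//; last exact: measurableT_comp.
rewrite (@ge0_integral_affine _ (b / D) (Num.sqrt D)^-1) ?invr_gt0//; last 2 first.
- exact: emeasurable_funM.
- by move=> x; rewrite !mule_ge0// lee_fin ?expR_ge0 ?phi_ge0.
rewrite -ge0_integralZl//; last 2 first.
- by apply: emeasurable_funM => //; exact: measurableT_comp.
- by move=> x _; rewrite mule_ge0// lee_fin phi_ge0.
apply: eq_integral => x _; rewrite !phiE.
set y := b / D + _.
rewrite [in LHS](muleC _ (k y)) -!muleA [RHS]muleCA; congr (k y * _)%E.
rewrite -!EFinM; congr EFin.
have E : expR (c + b * y + (1 - D) / 2 * y ^+ 2) * expR (- y ^+ 2 / 2) =
    expR (c + b ^+ 2 / (2 * D)) * expR (- x ^+ 2 / 2).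
  rewrite -!expRD; congr expR.
  suff -> : (1 - D) / 2 * y ^+ 2 =
      b ^+ 2 / (2 * D) - b * y - x ^+ 2 / 2 + y ^+ 2 / 2 by ring.
  rewrite {}/y; move: s0 sD; set s := Num.sqrt D => s0 <-.
  by field; rewrite gt_eqF.
transitivity (normal_peak 1 * (Num.sqrt D)^-1 *
  (expR (c + b * y + (1 - D) / 2 * y ^+ 2) * expR (- y ^+ 2 / 2))); first by ring.
by rewrite E; ring.
Qed.

(** The tilt with [D = 1]: the Cameron-Martin formula in one dimension. *)
Lemma ge0_integral_normal_shift (a : R) (k : R -> \bar R) :
  measurable_fun setT k -> (forall x, 0 <= k x)%E ->
  (\int[N01]_x k (a + x)%R =
   \int[N01]_x ((expR (a * x - a ^+ 2 / 2))%:E * k x))%E.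
Proof.
move=> mk k0.
have := @ge0_integral_normal_tilt 1 a (- (a ^+ 2 / 2)) k ltr01 mk k0.
rewrite sqrtr1 invr1 !mulr1 addNr expR0 mul1e.
under [X in _ = X -> _]eq_integral do rewrite mul1r.
move=> <-; apply: eq_integral => x _.
by congr ((expR _)%:E * _)%E; ring.
Qed.

Lemma ge0_integral_normal2 (f : R * R -> \bar R) :
  measurable_fun setT f -> (forall x, 0 <= f x)%E ->
  (\int[N01]_x \int[N01]_y f (x, y) =
   \int[leb]_x \int[leb]_y (f (x, y) * (phi x * phi y)%:E))%E.
Proof.
move=> mf f0; rewrite ge0_integral_normal; last 2 first.
- exact: (@measurable_fun_fubini_tonelli_F _ _ _ _ _ N01 f).
- by move=> x; apply: integral_ge0 => y _; exact: f0.
apply: eq_integral => x _; rewrite ge0_integral_normal//; last first.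
  exact: measurableT_comp.
rewrite -ge0_integralZr//.
- by apply: eq_integral => y _; rewrite -muleA -EFinM (mulrC (phi x)).
- apply: emeasurable_funM; first exact: measurableT_comp.
  by apply/measurable_EFinP; exact: measurable_phi.
- by move=> y _; rewrite mule_ge0// lee_fin phi_ge0.
- by rewrite lee_fin phi_ge0.
Qed.

(* For each [y], substitute [u = c x - s y]; for each [u], substitute
   [v = (y + s u) / c], which is [s x + c y]. *)
Lemma ge0_integral_normal_rot (c s : R) (f : R * R -> \bar R) :
  0 < c -> c ^+ 2 + s ^+ 2 = 1 ->
  measurable_fun setT f -> (forall x, 0 <= f x)%E ->
  (\int[N01]_x \int[N01]_y f (c * x - s * y, s * x + c * y)%R =
   \int[N01]_x \int[N01]_y f (x, y))%E.
Proof.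
move=> c0 cs1 mf f0.
have mlin (a b : R) : measurable_fun setT (fun z : R * R => a * z.1 + b * z.2).
  by apply: measurable_funD; apply: measurable_funM => //.
have maff (a b : R) : measurable_fun setT (fun x : R => a + b * x : R).
  by apply: measurable_funD => //; exact: measurable_funM.
have mphi g : measurable_fun setT g ->
    measurable_fun setT (fun z : R * R => phi (g z)).
  by move=> mg; apply: measurableT_comp => //; exact: measurable_phi.
pose rot (z : R * R) := (c * z.1 - s * z.2, s * z.1 + c * z.2).
have mrot : measurable_fun setT rot.
  apply: measurable_fun_pair; last exact: mlin.
  by under eq_fun do rewrite -mulNr; exact: mlin.
pose g1 (z : R * R) := (f (rot z) * (phi z.1 * phi z.2)%:E)%E.
have mg1 : measurable_fun setT g1.
  apply: emeasurable_funM; first exact: measurableT_comp.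
  by apply/measurable_EFinP; apply: measurable_funM; apply: mphi.
have g10 z : (0 <= g1 z)%E by rewrite mule_ge0// lee_fin mulr_ge0 ?phi_ge0.
pose sh (z : R * R) := (z.1, s / c * z.1 + c^-1 * z.2).
have msh : measurable_fun setT sh.
  by apply: measurable_fun_pair => //; exact: mlin.
pose g2 (z : R * R) := (f (sh z) * (phi (c^-1 * z.1 + s / c * z.2) * phi z.2 / c)%:E)%E.
have mg2 : measurable_fun setT g2.
  apply: emeasurable_funM; first exact: measurableT_comp.
  apply/measurable_EFinP; apply: measurable_funM => //.
  by apply: measurable_funM; apply: mphi => //; exact: mlin.
have g20 z : (0 <= g2 z)%E.
  by rewrite mule_ge0// lee_fin divr_ge0 ?mulr_ge0 ?phi_ge0// ltW.
rewrite (@ge0_integral_normal2 (f \o rot)); [| exact: measurableT_comp mf mrot | by move=> ?; exact: f0].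
transitivity (\int[leb]_y \int[leb]_x g1 (x, y))%E; first exact: fubini_tonelli.
transitivity (\int[leb]_y \int[leb]_x g2 (x, y))%E.
  apply: eq_integral => y _.
  rewrite (@ge0_integral_affine _ (s / c * y) c^-1) ?invr_gt0//; last first.
    exact: measurableT_comp.
  apply: eq_integral => u _; rewrite /g1 /g2 /rot /sh/=.
  rewrite -muleA -EFinM; congr (f (_, _) * _%:E)%E.
  - by field; rewrite gt_eqF.
  - transitivity ((c ^+ 2 + s ^+ 2) / c * y + s / c * u).
      by field; rewrite gt_eqF.
    by rewrite cs1; field; rewrite gt_eqF.
  - by rewrite (addrC (s / c * y)).
transitivity (\int[leb]_x \int[leb]_y g2 (x, y))%E.
  by apply/esym; exact: fubini_tonelli.
rewrite (ge0_integral_normal2 mf f0).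
apply: eq_integral => u _.
rewrite (@ge0_integral_affine _ (- s * u) c)//; last exact: measurableT_comp.
apply: eq_integral => v _; rewrite /g2 /sh/=.
rewrite -muleA -EFinM; congr (f (_, _) * _%:E)%E.
  by field; rewrite gt_eqF.
have -> : c^-1 * u + s / c * (- s * u + c * v) = c * u + s * v.
  transitivity ((1 - s ^+ 2) / c * u + s * v); first by field; rewrite gt_eqF.
  by rewrite -cs1 addrK; field; rewrite gt_eqF.
have E : expR (- (c * u + s * v) ^+ 2 / 2) * expR (- (- s * u + c * v) ^+ 2 / 2) =
    expR (- u ^+ 2 / 2) * expR (- v ^+ 2 / 2).
  rewrite -!expRD; congr expR.
  transitivity (- (c ^+ 2 + s ^+ 2) * (u ^+ 2 + v ^+ 2) / 2); first by field.
  by rewrite cs1; field.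
rewrite divfK ?gt_eqF// !phiE mulrACA E; ring.
Qed.

End Normal.

(** * Iterated Gaussian integrals *)

Definition rseq_display : measure_display.
Proof. exact: default_measure_display. Qed.

(** Vectors of every length live in this single space with its product sigma-algebra, padded with
    zeros, so that no dimension occurs in the types during the inductions. *)
Definition rseq (R : realType) : Type := nat -> R.

Section RealSequences.
Context {R : realType}.

HB.instance Definition _ := Pointed.copy (rseq R) (nat -> R).

Definition rseq_measurable : set (set (rseq R)) :=
  <<s \bigcup_(i in [set: nat])
        preimage_set_system setT (fun v : rseq R => v i) measurable >>.

Let rseq_set0 : rseq_measurable set0. Proof. exact: sigma_algebra0. Qed.

Let rseq_setC A : rseq_measurable A -> rseq_measurable (~` A).
Proof. exact: sigma_algebraC. Qed.

Let rseq_bigcup (F : (set (rseq R))^nat) :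
  (forall i, rseq_measurable (F i)) -> rseq_measurable (\bigcup_i (F i)).
Proof. exact: sigma_algebra_bigcup. Qed.

HB.instance Definition _ := @isMeasurable.Build rseq_display (rseq R)
  rseq_measurable rseq_set0 rseq_setC rseq_bigcup.

Lemma measurable_coord (i : nat) : measurable_fun setT (fun v : rseq R => v i).
Proof.
move=> _ B mB; rewrite setTI; apply: sub_sigma_algebra => /=.
by exists i => //; exists B => //; rewrite setTI.
Qed.

Lemma measurable_fun_rseqP d (T : measurableType d) (f : T -> rseq R) :
  measurable_fun setT f <-> forall i, measurable_fun setT (fun x => f x i).
Proof.
split=> [mf i|mf].
  exact: (measurableT_comp (measurable_coord i) mf).
move=> _ A mA; rewrite setTI.
suff : rseq_measurable `<=` [set A | measurable (f @^-1` A)] by exact.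
apply: smallest_sub.
  split => /=.
  - by rewrite preimage_set0.
  - by move=> B mB; rewrite setTD -preimage_setC; exact: measurableC.
  - by move=> F mF; rewrite preimage_bigcup; exact: bigcup_measurable.
move=> _ [i _] [B mB <-] /=.
have := mf i measurableT B mB.
by rewrite !setTI.
Qed.

End RealSequences.

Section GaussianIntegral.
Context {R : realType}.
Local Notation N01 := (normal_prob (0 : R) (1 : R)).
Implicit Types (v l : rseq R) (ls : seq (rseq R)) (F : rseq R -> \bar R).

Definition translate v (x : R) l : rseq R := fun i => v i + x * l i.

(* The expectation of [F (v + \sum_l xi_l l)], for independent standard normal
   coefficients [xi_l], one for each direction [l] of the list [ls]. *)
Fixpoint gint ls F v : \bar R :=
  if ls is l :: ls' then (\int[N01]_x gint ls' F (translate v x l))%E else F v.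

Lemma measurable_translate d (T : measurableType d) (f : T -> rseq R) (g : T -> R) l :
  measurable_fun setT f -> measurable_fun setT g ->
  measurable_fun setT (fun x => translate (f x) (g x) l).
Proof.
move=> /measurable_fun_rseqP mf mg; apply/measurable_fun_rseqP => i.
by apply: measurable_funD => //; exact: measurable_funM.
Qed.

Lemma translateC v x l y l' : translate (translate v x l) y l' = translate (translate v y l') x l.
Proof. by apply/funext => i; rewrite /translate addrAC. Qed.

Lemma gint_ge0 ls F v : (forall w, 0 <= F w)%E -> (0 <= gint ls F v)%E.
Proof.
by move=> F0; elim: ls v => //= l ls IH v; apply: integral_ge0 => x _; exact: IH.
Qed.

Lemma eq_gint ls F G v : F =1 G -> gint ls F v = gint ls G v.
Proof. by move=> /funext ->. Qed.

(** The parameter is an observed value, or the state while the observations are integrated.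
    Tonelli's theorem requires joint measurability in it. *)
Lemma measurable_gint_param d (T : measurableType d) ls
    (F : T * rseq R -> \bar R) :
  measurable_fun setT F -> (forall z, 0 <= F z)%E ->
  measurable_fun setT (fun z : T * rseq R => gint ls (fun v => F (z.1, v)) z.2).
Proof.
move=> mF F0; elim: ls => [|l ls IH] /=.
  by apply: eq_measurable_fun mF => -[].
pose H (z : (T * rseq R) * R) := gint ls (fun v => F (z.1.1, v)) (translate z.1.2 z.2 l).
have mH : measurable_fun setT H.
  apply: (measurableT_comp IH (g := fun z : (T * rseq R) * R => (z.1.1, translate z.1.2 z.2 l))).
  apply: measurable_fun_pair; first exact: measurableT_comp.
  by apply: measurable_translate => //; exact: measurableT_comp.
apply: (@measurable_fun_fubini_tonelli_F _ _ _ _ _ N01 H) => // z.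
by apply: gint_ge0 => w; exact: F0.
Qed.

Lemma measurable_gint ls F :
  measurable_fun setT F -> (forall z, 0 <= F z)%E ->
  measurable_fun setT (gint ls F).
Proof.
move=> mF F0.
have := @measurable_gint_param _ unit ls (F \o snd).
move=> /(_ (measurableT_comp mF measurable_snd) (fun=> F0 _)) H.
exact: (measurableT_comp H (pair1_measurable tt)).
Qed.

Lemma measurable_gint_translate ls F v l :
  measurable_fun setT F -> (forall z, 0 <= F z)%E ->
  measurable_fun setT (fun x => gint ls F (translate v x l)).
Proof.
move=> mF F0; apply: (measurableT_comp (measurable_gint ls mF F0)).
exact: measurable_translate.
Qed.

Lemma gint_pull ls (w : rseq R -> \bar R) F v :
  measurable_fun setT F -> (forall z, 0 <= F z)%E -> (forall z, 0 <= w z)%E ->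
  (forall l, l \in ls -> forall z x, w (translate z x l) = w z) ->
  gint ls (fun z => w z * F z)%E v = (w v * gint ls F v)%E.
Proof.
move=> mF F0 w0; elim: ls v => //= l ls IH v wl.
rewrite -ge0_integralZl//.
- apply: eq_integral => x _; rewrite IH.
    by rewrite wl// mem_head.
  by move=> l' ll' z y; rewrite wl// inE ll' orbT.
- exact: measurable_gint_translate.
- by move=> x _; exact: gint_ge0.
Qed.

Lemma integral_normal_cst (c : \bar R) : (\int[N01]_x c = c)%E.
Proof.
rewrite integral_cst//= [X in (_ * X)%E](_ : _ = 1%E) ?mule1//.
exact: (@probability_setT _ _ _ (normal_prob 0 1 : probability _ R)).
Qed.

Lemma gint_id ls F v :
  (forall l, l \in ls -> forall z x, F (translate z x l) = F z) -> gint ls F v = F v.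
Proof.
elim: ls v => //= l ls IH v Fl.
rewrite (eq_integral (fun=> F v)) ?integral_normal_cst// => x _.
by rewrite IH ?Fl ?mem_head// => l' ll' z y; rewrite Fl// inE ll' orbT.
Qed.

Lemma gint_integral ls (F : R * rseq R -> \bar R) v :
  measurable_fun setT F -> (forall z, 0 <= F z)%E ->
  gint ls (fun z => \int[N01]_u F (u, z))%E v =
  (\int[N01]_u gint ls (fun z => F (u, z)) v)%E.
Proof.
move=> mF F0; elim: ls v => //= l ls IH v.
under eq_integral do rewrite IH.
pose H (z : R * R) := gint ls (fun w => F (z.2, w)) (translate v z.1 l).
apply: (@fubini_tonelli _ _ _ _ _ N01 N01 H) => [|z]; last first.
  by apply: gint_ge0 => w; exact: F0.
apply: (measurableT_comp (measurable_gint_param ls mF F0)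
  (g := fun z : R * R => (z.2, translate v z.1 l))).
apply: measurable_fun_pair => //.
exact: measurable_translate.
Qed.

Lemma gint_swap l1 l2 ls F v :
  measurable_fun setT F -> (forall z, 0 <= F z)%E ->
  gint (l1 :: l2 :: ls) F v = gint (l2 :: l1 :: ls) F v.
Proof.
move=> mF F0 /=.
pose H (z : R * R) := gint ls F (translate (translate v z.1 l1) z.2 l2).
rewrite [LHS](@fubini_tonelli _ _ _ _ _ N01 N01 H).
- by under eq_integral do under eq_integral do rewrite /H/= translateC.
- apply: (measurableT_comp (measurable_gint ls mF F0)).
  by do 2 apply: measurable_translate => //.
- by move=> z; exact: gint_ge0.
Qed.

Lemma gint_rot (c s : R) l1 l2 ls F v :
  0 < c -> c ^+ 2 + s ^+ 2 = 1 ->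
  measurable_fun setT F -> (forall z, 0 <= F z)%E ->
  gint (l1 :: l2 :: ls) F v =
  gint ((fun i => c * l1 i + s * l2 i) :: (fun i => - s * l1 i + c * l2 i) :: ls)
    F v.
Proof.
move=> c0 cs1 mF F0 /=.
pose H (z : R * R) := gint ls F (translate (translate v z.1 l1) z.2 l2).
have <- := @ge0_integral_normal_rot _ c s H c0 cs1.
- apply: eq_integral => x _; apply: eq_integral => y _.
  by congr (gint ls F _); apply/funext => i; rewrite /translate/=; ring.
- apply: (measurableT_comp (measurable_gint ls mF F0)).
  by do 2 apply: measurable_translate => //.
- by move=> z; exact: gint_ge0.
Qed.

(** The image of a Gaussian law under an affine map: compatibility with translations is the form of
    affinity that the induction on directions consumes. *)
Lemma gint_map (I : eqType) (s : seq I) (e c : I -> rseq R)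
    (g : rseq R -> rseq R) F v :
  (forall j, j \in s -> forall z x, g (translate z x (e j)) = translate (g z) x (c j)) ->
  gint (map e s) (F \o g) v = gint (map c s) F (g v).
Proof.
elim: s v => //= j s IH v gs; apply: eq_integral => x _.
rewrite IH; first by rewrite gs// mem_head.
by move=> i si z y; rewrite gs// inE si orbT.
Qed.

Definition cov ls (i j : nat) : R := \sum_(l <- ls) l i * l j.

(* Givens rotations carry the [i]-th coordinate of all directions to the first. *)
Lemma gint_pivot (i : nat) ls : exists l0 ls',
  [/\ forall l, l \in ls' -> l i = 0,
      forall j k, cov ls j k = l0 j * l0 k + cov ls' j k &
      forall F v, measurable_fun setT F -> (forall z, 0 <= F z)%E ->
        gint ls F v = gint (l0 :: ls') F v].
Proof.
elim: ls => [|l ls [l0 [ls' [ls'0 covE gintE]]]].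
  exists (fun=> 0), [::]; split => //.
    by move=> j k; rewrite /cov !big_nil mul0r addr0.
  move=> F v _ _ /=; rewrite -[LHS]integral_normal_cst.
  by apply: eq_integral => x _; congr F; apply/funext => j; rewrite /translate mulr0 addr0.
have E F v : measurable_fun setT F -> (forall z, 0 <= F z)%E ->
    gint (l :: ls) F v = gint (l :: l0 :: ls') F v.
  by move=> mF F0; apply: eq_integral => x _; exact: gintE.
have C j k : cov (l :: ls) j k = l j * l k + (l0 j * l0 k + cov ls' j k).
  by rewrite {1}/cov big_cons -/(cov _ _ _) covE.
have C' (l1 : rseq R) j k : cov (l1 :: ls') j k = l1 j * l1 k + cov ls' j k.
  by rewrite /cov big_cons.
have [l0i|l0i] := eqVneq (l0 i) 0.
  exists l, (l0 :: ls'); split => // [l1|j k].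
    by rewrite inE => /predU1P[->//|/ls'0].
  by rewrite C C'.
(* Here the cosine of the rotation would vanish, while [gint_rot] requires it to be positive;
   exchanging the two directions does the same work. *)
have [li|li] := eqVneq (l i) 0.
  exists l0, (l :: ls'); split => // [l1|j k|F v mF F0].
  - by rewrite inE => /predU1P[->//|/ls'0].
  - by rewrite C C' addrCA.
  - by rewrite (E _ _ mF F0) (gint_swap _ _ _ _ mF F0).
(* The sign makes the cosine [l i / n] positive. *)
pose n := Num.sg (l i) * Num.sqrt (l i ^+ 2 + l0 i ^+ 2).
have n2 : n ^+ 2 = l i ^+ 2 + l0 i ^+ 2.
  rewrite exprMn sqr_sg li mul1r sqr_sqrtr//.
  by rewrite addr_ge0// sqr_ge0.
have n0 : n != 0.
  by rewrite -sqrf_eq0 n2 gt_eqF// ltr_pwDl// ?sqr_ge0// exprn_even_gt0.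
have c0 : 0 < l i / n.
  have -> : l i / n = l i * n / n ^+ 2 by field.
  rewrite divr_gt0 ?exprn_even_gt0// /n mulrA (mulrC (l i)) -normrEsg.
  by rewrite mulr_gt0 ?normr_gt0// sqrtr_gt0 -n2 exprn_even_gt0.
have cs1 : (l i / n) ^+ 2 + (l0 i / n) ^+ 2 = 1.
  by rewrite !expr_div_n -mulrDl -n2 divff// expf_neq0.
exists (fun j => l i / n * l j + l0 i / n * l0 j),
  ((fun j => - (l0 i / n) * l j + l i / n * l0 j) :: ls'); split.
- move=> l1; rewrite inE => /predU1P[->|/ls'0//].
  by field.
- move=> j k; rewrite C C' addrA addrA; congr (_ + _).
  transitivity (((l i / n) ^+ 2 + (l0 i / n) ^+ 2) * (l j * l k + l0 j * l0 k)).
    by rewrite cs1 mul1r.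
  by ring.
- move=> F v mF F0; by rewrite (E _ _ mF F0) (gint_rot l l0 ls' v c0 cs1 mF F0).
Qed.

End GaussianIntegral.

(** * Elimination of the observations *)

Section OneStep.
Context {R : realType}.
Local Notation N01 := (normal_prob (0 : R) (1 : R)).
Implicit Types (v l z : rseq R) (ls : seq (rseq R)).

(** After pivoting, coordinate [i] moves along one direction only, and the other integrals are those
    of constants. The scale [s] is chosen before [c], so that different centres are compared under
    the same Gaussian law. *)
Lemma gint_exp_sqE ls (i : nat) (k : R) z : exists s : R, forall c,
  gint ls (fun v => (expR (k * (v i - c) ^+ 2))%:E) z =
  (\int[N01]_x (expR (k * (z i - c + s * x) ^+ 2))%:E)%E.
Proof.
have [l0 [ls' [ls'0 _ gintE]]] := gint_pivot i ls.
exists (l0 i) => c; rewrite gintE/=; last 2 first.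
- apply/measurable_EFinP; apply: measurableT_comp => //.
  apply: measurable_funM => //; apply: measurable_funX.
  by apply: measurable_funB => //; exact: measurable_coord.
- by move=> v; rewrite lee_fin expR_ge0.
apply: eq_integral => x _; rewrite gint_id.
  by rewrite /translate addrAC (mulrC x).
by move=> l ll' v y; rewrite /translate/= (ls'0 _ ll') mulr0 addr0.
Qed.

(* Symmetrise in [x] and use [cosh >= 1]: the integrals may be infinite. *)
Lemma gint_exp_sq_min ls (i : nat) (k c : R) z : 0 <= k ->
  (gint ls (fun v => (expR (k * (v i - z i) ^+ 2))%:E) z <=
   gint ls (fun v => (expR (k * (v i - c) ^+ 2))%:E) z)%E.
Proof.
move=> k0; have [s EE] := gint_exp_sqE ls i k z.
rewrite !EE subrr; set d := z i - c.
have mE b : measurable_fun setT (fun x : R => (expR (k * (b + s * x) ^+ 2))%:E).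
  apply/measurable_EFinP; apply: measurableT_comp => //.
  apply: measurable_funM => //; apply: measurable_funX.
  by apply: measurable_funD => //; exact: measurable_funM.
have E0 b x : (0 <= (expR (k * (b + s * x) ^+ 2))%:E)%E.
  by rewrite lee_fin expR_ge0.
have mN : measurable_fun setT (fun x : R => - x : R) by exact: measurableT_comp.
have twice b : (2%:E * \int[N01]_x (expR (k * (b + s * x) ^+ 2))%:E =
    \int[N01]_x ((expR (k * (b + s * x) ^+ 2))%:E +
                 (expR (k * (b + s * - x) ^+ 2))%:E))%E.
  rewrite ge0_integralD; [|exact: measurableT|by []|exact: mE|by []|exact: (measurableT_comp (mE b) mN)].
  have H := ge0_integral_normal_opp (mE b) (E0 b).
  transitivity (\int[N01]_x (expR (k * (b + s * x) ^+ 2))%:E +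
                \int[N01]_x (expR (k * (b + s * x) ^+ 2))%:E)%E.
    by rewrite -[2]/(1 + 1)%:R natrD EFinD ge0_muleDl ?lee_fin// mul1e.
  by congr (_ + _)%E; rewrite -H.
rewrite -(@lee_pmul2l _ 2%:E) ?lte_fin// !twice; apply: ge0_le_integral => //.
- by move=> x _; rewrite adde_ge0.
- apply: emeasurable_funD; [exact: mE|exact: (measurableT_comp (mE 0) mN)].
- apply: emeasurable_funD; [exact: mE|exact: (measurableT_comp (mE d) mN)].
- move=> x _; rewrite -!EFinD lee_fin.
  set t := k * s * x * d * 2; set q := k * (0 + s * x) ^+ 2.
  have -> : k * (0 + s * - x) ^+ 2 = q by rewrite /q; ring.
  have -> : k * (d + s * x) ^+ 2 = q + k * d ^+ 2 + t by rewrite /q /t; ring.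
  have -> : k * (d + s * - x) ^+ 2 = q + k * d ^+ 2 - t by rewrite /q /t; ring.
  rewrite !expRD -mulrDr.
  have q0 := expR_gt0 q.
  have kd : 1 <= expR (k * d ^+ 2) by rewrite -[1]expR0 ler_expR mulr_ge0// sqr_ge0.
  have tt : 2 <= expR t + expR (- t).
    have t0 := expR_gt0 t; have tV : expR t * expR (- t) = 1.
      by rewrite -expRD subrr expR0.
    have := sqr_ge0 (expR t - 1).
    have := expR_gt0 (- t).
    move: t0 tV; set A := expR t; set B := expR (- t); nra.
  rewrite -[X in X <= _]mulr2n -mulr_natr -mulrA ler_pM2l//.
  by rewrite -[X in X <= _]mul1r ler_pM.
Qed.

(** For [k <= 0] the integrals are finite and explicit: with [D = 1 - 2 * k * s ^+ 2] and
    [d = z i - c], the tilt gives [expR (k * d ^+ 2 / D) / Num.sqrt D], which is largest at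
    [d = 0]. *)
Lemma gint_exp_sq_max ls (i : nat) (k c : R) z : k <= 0 ->
  (gint ls (fun v => (expR (k * (v i - c) ^+ 2))%:E) z <=
   gint ls (fun v => (expR (k * (v i - z i) ^+ 2))%:E) z)%E.
Proof.
move=> k0; have [s EE] := gint_exp_sqE ls i k z.
rewrite !EE subrr; set d := z i - c.
have tilt b : (\int[N01]_x (expR (k * (b + s * x) ^+ 2))%:E =
  (expR (k * b ^+ 2 + (2 * k * s * b) ^+ 2 / (2 * (1 - 2 * k * s ^+ 2)))
     / Num.sqrt (1 - 2 * k * s ^+ 2))%:E)%E.
  have D0 : 0 < 1 - 2 * k * s ^+ 2.
    by have := sqr_ge0 s; nra.
  have := @ge0_integral_normal_tilt R _ (2 * k * s * b) (k * b ^+ 2) (fun=> 1%E) D0.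
  rewrite integral_normal_cst mule1 => <-//.
  apply: eq_integral => x _; rewrite mule1; congr (expR _)%:E.
  by field.
rewrite !tilt.
have D0 : 0 < 1 - 2 * k * s ^+ 2 by have := sqr_ge0 s; nra.
rewrite lee_fin ler_pM2r ?invr_gt0 ?sqrtr_gt0// ler_expR.
rewrite (_ : _ + _ = k * d ^+ 2 / (1 - 2 * k * s ^+ 2)); last first.
  by field; rewrite gt_eqF.
rewrite expr0n/= !mulr0 expr0n/= mul0r addr0.
by rewrite pmulr_lle0 ?invr_gt0// mulr_le0_ge0 ?sqr_ge0.
Qed.

(** After pivoting at [l], the tilt with [D = 1 + S * g] divides the pivot direction by [Num.sqrt D]
    and leaves the others alone; since [g] is the square of the pivot's coordinate [l], this is the
    stated change of covariance. The order of the quantifiers matters: [ls'] depends neither on the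
    observations nor on the filter, and [C] does not depend on [F], so that two integrands get the
    same factor. *)
Lemma gint_step ls (l : nat) (a rho : R) :
  let S := a ^+ 2 - rho in let g := cov ls l l in
  0 < 1 + S * g ->
  exists ls',
    (forall j k, cov ls' j k =
       cov ls j k - cov ls j l * cov ls k l * (S / (1 + S * g))) /\
    forall (h : R -> R) z, measurable_fun setT h ->
    exists2 C : R -> R, measurable_fun setT C /\ (forall u, 0 <= C u) &
    forall F : R * rseq R -> \bar R,
      measurable_fun setT F -> (forall t, 0 <= F t)%E ->
      gint ls (fun v => \int[N01]_u
        ((expR (a * u * v l - a ^+ 2 * v l ^+ 2 / 2 + rho / 2 * (v l - h u) ^+ 2))%:E
           * F (u, v)))%E z =
      (\int[N01]_u ((C u)%:E * gint ls' (fun v => F (u, v))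
        (fun j => z j + cov ls j l *
           (a * (u - a * z l) + rho * (z l - h u)) / (1 + S * g))%R))%E.
Proof.
move=> S g D0.
have [l0 [ls0 [ls00 covE gintE]]] := gint_pivot l ls.
set s := l0 l; set D := 1 + S * g.
have ls0l j : cov ls0 j l = 0.
  by rewrite /cov big_seq big1// => l' /ls00 ->; rewrite mulr0.
have covl j : cov ls j l = l0 j * s by rewrite covE ls0l addr0.
have gE : g = s ^+ 2 by rewrite /g covl.
have sD0 : 0 < Num.sqrt D by rewrite sqrtr_gt0.
have sDE : Num.sqrt D ^+ 2 = D by rewrite sqr_sqrtr// ltW.
exists ((fun j => (Num.sqrt D)^-1 * l0 j) :: ls0); split.
  move=> j k; rewrite {1}/cov big_cons -/(cov _ _ _) covE !covl.
  have -> : (Num.sqrt D)^-1 * l0 j * ((Num.sqrt D)^-1 * l0 k) = l0 j * l0 k / D.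
    by move: sD0 sDE; set q := Num.sqrt D => q0 <-; field; rewrite gt_eqF.
  by move: D0; rewrite -/D /D gE => D0; field; rewrite gt_eqF.
move=> h z mh.
(* [c u] and [b u] are the constant and linear coefficients of the exponent at [z l + s * x], as a
   polynomial in [x]; the quadratic one is [- S * s ^+ 2 / 2 = (1 - D) / 2]. *)
pose b u := s * (a * (u - a * z l) + rho * (z l - h u)).
pose c u := a * u * z l - a ^+ 2 * z l ^+ 2 / 2 + rho / 2 * (z l - h u) ^+ 2.
have mb : measurable_fun setT b.
  apply: measurable_funM => //; apply: measurable_funD.
    by apply: measurable_funM => //; exact: measurable_funB.
  by apply: measurable_funM => //; exact: measurable_funB.
have mc : measurable_fun setT c.
  apply: measurable_funD.
    by apply: measurable_funB => //; do 2 apply: measurable_funM => //.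
  by apply: measurable_funM => //; apply: measurable_funX; exact: measurable_funB.
exists (fun u => expR (c u + b u ^+ 2 / (2 * D)) / Num.sqrt D).
  split=> [|u]; last by rewrite divr_ge0 ?expR_ge0// ltW.
  apply: measurable_funM => //; apply: measurableT_comp => //.
  by apply: measurable_funD => //; apply: measurable_funM => //; exact: measurable_funX.
move=> F mF F0.
pose w u (x : R) := expR (a * u * x - a ^+ 2 * x ^+ 2 / 2 + rho / 2 * (x - h u) ^+ 2).
pose G (t : R * rseq R) := ((w t.1 (t.2 l))%:E * F t)%E.
have G0 t : (0 <= G t)%E by rewrite mule_ge0// lee_fin expR_ge0.
have mw : measurable_fun setT (fun t : R * R => w t.1 t.2).
  apply: measurableT_comp => //; apply: measurable_funD.
    apply: measurable_funB; first by do 2 apply: measurable_funM => //.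
    by do 2 apply: measurable_funM => //; exact: measurable_funX.
  apply: measurable_funM => //; apply: measurable_funX; apply: measurable_funB => //.
  exact: measurableT_comp.
have mG : measurable_fun setT G.
  apply: emeasurable_funM => //; apply/measurable_EFinP.
  apply: (measurableT_comp mw (g := fun t : R * rseq R => (t.1, t.2 l))).
  apply: measurable_fun_pair => //.
  by apply: (measurableT_comp (measurable_coord l)).
rewrite (gint_integral ls z mG G0); apply: eq_integral => u _.
have mFu : measurable_fun setT (fun v => F (u, v)) by exact: measurableT_comp.
have F0u v : (0 <= F (u, v))%E by exact: F0.
rewrite gintE; [|by exact: (measurableT_comp mG)|by move=> v; exact: G0].
rewrite /=.
pose k x := gint ls0 (fun v => F (u, v)) (translate z x l0).
have mk : measurable_fun setT k by exact: measurable_gint_translate.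
transitivity (\int[N01]_x ((expR (c u + b u * x + (1 - D) / 2 * x ^+ 2))%:E * k x))%E.
  apply: eq_integral => x _.
  rewrite (@gint_pull _ _ (fun v => (w u (v l))%:E))//; last 2 first.
  - by move=> v; rewrite lee_fin expR_ge0.
  - by move=> l' ll' v y; rewrite /translate/= (ls00 _ ll') mulr0 addr0.
  congr (_%:E * _)%E; rewrite /w; congr expR.
  by rewrite /translate /c /b /D gE /S -/s; field.
rewrite ge0_integral_normal_tilt//; last by move=> x; exact: gint_ge0.
congr (_ * _)%E; apply: eq_integral => x _; rewrite /k.
congr gint; apply/funext => j; rewrite /translate covl /b -/D.
by field; rewrite !gt_eqF.
Qed.

End OneStep.

(** * Propagation of an inequality through the successive observations *)

Section Comparison.
Context {R : realType}.
Local Notation N01 := (normal_prob (0 : R) (1 : R)).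
Implicit Types (x y z : rseq R) (ls : seq (rseq R)).

Definition unitv (k : nat) : rseq R := fun i => (i == k)%:R.

Lemma translate_unit y u k : translate y u (unitv k) k = y k + u.
Proof. by rewrite /translate /unitv eqxx mulr1. Qed.

Lemma translate_unit_neq y u k i : i != k -> translate y u (unitv k) i = y i.
Proof. by rewrite /translate /unitv => /negbTE ->; rewrite mulr0 addr0. Qed.

Variables (n : nat) (m : rseq R) (K gam : nat -> nat -> R) (a rho : rseq R).

(* Indices are shifted by one with respect to the paper.  [filt k y] solves the
   filter equation of index [k + 1] for the observations [y], and [filt_base k y i]
   is [m_(i + 1)] plus the contribution of the first [k] observations. *)
Fixpoint filt_base (k : nat) (y : rseq R) : rseq R :=
  if k is k'.+1 then
    fun i => filt_base k' y i + gam i k' * a k' * (y k' - a k' *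
      ((filt_base k' y k' + a k' * gam k' k' * y k') /
         (1 + a k' ^+ 2 * gam k' k')))
  else m.

Definition filt (k : nat) (y : rseq R) : R :=
  (filt_base k y k + a k * gam k k * y k) / (1 + a k ^+ 2 * gam k k).

(** Adaptedness of the filter: it lets the later observations be integrated while the earlier costs
    stay fixed. *)
Lemma filt_base_translate k j y u : (k <= j)%N ->
  filt_base k (translate y u (unitv j)) = filt_base k y.
Proof.
elim: k => //= k IH kj; rewrite IH ?(ltnW kj)// translate_unit_neq//.
by rewrite ltn_eqF.
Qed.

Lemma filt_translate k j y u : (k < j)%N -> filt k (translate y u (unitv j)) = filt k y.
Proof.
by move=> kj; rewrite /filt filt_base_translate ?(ltnW kj)// translate_unit_neq// ltn_eqF.
Qed.

Lemma measurable_filt_base k i : measurable_fun setT (fun y => filt_base k y i).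
Proof.
elim: k i => [|k IH] i /=; first exact: measurable_cst.
apply: measurable_funD; first exact: IH.
apply: measurable_funM => //; apply: measurable_funB; first exact: measurable_coord.
apply: measurable_funM => //; apply: measurable_funM => //.
apply: measurable_funD; first exact: IH.
by apply: measurable_funM => //; exact: measurable_coord.
Qed.

Lemma measurable_filt k : measurable_fun setT (filt k).
Proof.
apply: measurable_funM => //; apply: measurable_funD.
  exact: measurable_filt_base.
by apply: measurable_funM => //; exact: measurable_coord.
Qed.

(** The log-likelihood of the [s]-th observation relative to the standard normal law, plus the
    [s]-th cost. *)
Definition tilt1 s (x y : rseq R) : R :=
  a s * y s * x s - a s ^+ 2 * x s ^+ 2 / 2 + rho s / 2 * (x s - filt s y) ^+ 2.

Definition tilt k (x y : rseq R) : R := \sum_(k <= s < n) tilt1 s x y.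

Lemma measurable_tilt1 s :
  measurable_fun setT (fun t : rseq R * rseq R => tilt1 s t.1 t.2).
Proof.
have m1 : measurable_fun setT (fun t : rseq R * rseq R => t.1 s).
  exact: (measurableT_comp (measurable_coord s) measurable_fst).
have m2 : measurable_fun setT (fun t : rseq R * rseq R => t.2 s).
  exact: (measurableT_comp (measurable_coord s) measurable_snd).
apply: measurable_funD.
  apply: measurable_funB.
    by apply: measurable_funM => //; exact: measurable_funM.
  by apply: measurable_funM => //; apply: measurable_funM => //; exact: measurable_funX.
apply: measurable_funM => //; apply: measurable_funX; apply: measurable_funB => //.
exact: (measurableT_comp (measurable_filt s) measurable_snd).
Qed.

Lemma measurable_tilt k :
  measurable_fun setT (fun t : rseq R * rseq R => tilt k t.1 t.2).
Proof. by apply: measurable_sum => s; exact: measurable_tilt1. Qed.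

Definition units k := [seq unitv j | j <- iota k (n - k)].

Lemma units_cons k : (k < n)%N -> units k = unitv k :: units k.+1.
Proof. by move=> kn; rewrite /units -(subnSK kn). Qed.

Let S s := a s ^+ 2 - rho s.

(* The covariance of [X] left after the first [k] observations under the tilted
   measure. *)
Definition pseudo_cov k i j :=
  K i j - \sum_(0 <= s < k) gam i s * gam j s * (S s / (1 + S s * gam s s)).

Hypothesis n0 : (0 < n)%N.
Hypothesis gamE : forall i s, (s <= i < n)%N -> gam i s = pseudo_cov s i s.
Hypothesis gam0 : forall s, (s < n)%N -> 0 <= gam s s.
Hypothesis gamD : forall s, (s < n)%N -> 0 < 1 + S s * gam s s.

Variables F1 F2 : rseq R * rseq R -> \bar R.
Hypotheses (mF1 : measurable_fun setT F1) (mF2 : measurable_fun setT F2).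
Hypotheses (F10 : forall t, (0 <= F1 t)%E) (F20 : forall t, (0 <= F2 t)%E).
Hypothesis F12 : forall ls z y, z n.-1 = filt_base n y n.-1 ->
  (gint ls (fun x => F1 (x, y)) z <= gint ls (fun x => F2 (x, y)) z)%E.

Let tilted k (F : rseq R * rseq R -> \bar R) x y :=
  gint (units k) (fun y' => (expR (tilt k x y'))%:E * F (x, y'))%E y.

Let measurable_tilted k F : measurable_fun setT F -> (forall t, 0 <= F t)%E ->
  measurable_fun setT (fun t : rseq R * rseq R => tilted k F t.1 t.2).
Proof.
move=> mF F0.
apply: (measurable_gint_param (units k)
  (F := fun t => ((expR (tilt k t.1 t.2))%:E * F t)%E)).
  apply: emeasurable_funM; last by [].
  by apply/measurable_EFinP; apply: measurableT_comp => //; exact: measurable_tilt.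
by move=> t; rewrite mule_ge0// lee_fin expR_ge0.
Qed.

Let tilted_ge0 k F x y : (forall t, 0 <= F t)%E -> (0 <= tilted k F x y)%E.
Proof. by move=> F0; apply: gint_ge0 => w; rewrite mule_ge0// lee_fin expR_ge0. Qed.

(** By adaptedness, the factor of index [k] is constant along the later observations and leaves
    their integrals. Starting from [y k = 0] makes the [k]-th observation the integration variable
    itself. *)
Let tilted_step k F x y : (k < n)%N -> y k = 0 ->
  measurable_fun setT F -> (forall t, 0 <= F t)%E ->
  tilted k F x y = (\int[N01]_u
    ((expR (a k * u * x k - a k ^+ 2 * x k ^+ 2 / 2 +
        rho k / 2 * (x k - filt k (translate y u (unitv k))) ^+ 2))%:E *
      tilted k.+1 F x (translate y u (unitv k))))%E.
Proof.
move=> kn yk mF F0; rewrite /tilted units_cons//=.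
apply: eq_integral => u _.
pose w y' := (expR (tilt1 k x y'))%:E.
pose G y' := ((expR (tilt k.+1 x y'))%:E * F (x, y'))%E.
rewrite (_ : (fun y' => _) = (fun y' => w y' * G y')%E); last first.
  by apply/funext => y'; rewrite /tilt big_ltn// expRD EFinM muleA.
rewrite gint_pull.
- by rewrite /w /tilt1 translate_unit yk add0r.
- apply: emeasurable_funM; last exact: measurableT_comp.
  apply/measurable_EFinP; apply: measurableT_comp => //.
  exact: (measurableT_comp (measurable_tilt k.+1) (pair1_measurable x)).
- by move=> y'; rewrite mule_ge0// lee_fin expR_ge0.
- by move=> y'; rewrite lee_fin expR_ge0.
- move=> l /mapP[j]; rewrite mem_iota => /andP[kj _ ->] y' b.
  by rewrite /w /tilt1 filt_translate// translate_unit_neq// ltn_eqF.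
Qed.

(** Induction on the number of remaining observations. The hypotheses are the invariant: the current
    mean is the partial filter, the remaining observations are still at 0, and the current
    covariance is [pseudo_cov k]. At each step both sides become integrals over [u] with the same
    factor [C u], hence are compared pointwise in [u]. The bound [k <= i.+1] keeps the coordinate
    just observed, which [F12] uses once [k = n]. *)
Lemma tilted_le k ls z y : (k <= n)%N ->
  (forall i, (k <= i.+1)%N -> (i < n)%N -> z i = filt_base k y i) ->
  (forall i, (k <= i)%N -> y i = 0) ->
  (forall i j, (k <= i < n)%N -> (k <= j < n)%N -> cov ls i j = pseudo_cov k i j) ->
  (gint ls (fun x => tilted k F1 x y) z <= gint ls (fun x => tilted k F2 x y) z)%E.
Proof.
move=> kn; have [j nE] : exists j, (n = k + j)%N by exists (n - k)%N; rewrite subnKC.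
elim: j k ls z y kn nE => [|j IH] k ls z y kn nE zE y0 covE.
  have {nE} kE : k = n by rewrite nE addn0.
  have tE F x : tilted k F x y = F (x, y).
    by rewrite /tilted /units kE subnn/= /tilt big_geq// expR0 mul1e.
  rewrite (eq_gint _ _ (tE F1)) (eq_gint _ _ (tE F2)).
  by apply: F12; rewrite -[in filt_base n]kE zE ?kE ?prednK.
have {}kn : (k < n)%N by rewrite nE -addSnnS leq_addr.
have covk i : (k <= i < n)%N -> cov ls i k = gam i k.
  by move=> ki; rewrite covE ?leqnn// -gamE.
have covkk : cov ls k k = gam k k by rewrite covk// leqnn.
have D0 : 0 < 1 + S k * cov ls k k by rewrite covkk gamD.
have [ls' [covE' stepE]] := gint_step D0.
pose h u := filt k (translate y u (unitv k)).
have mh : measurable_fun setT h.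
  exact: (measurableT_comp (measurable_filt k) (measurable_translate _ (measurable_cst _) _)).
have [C [mC C0] CE] := stepE h z mh.
pose G F (t : R * rseq R) := tilted k.+1 F t.2 (translate y t.1 (unitv k)).
have mG F : measurable_fun setT F -> (forall t, 0 <= F t)%E -> measurable_fun setT (G F).
  move=> mF F0; apply: (measurableT_comp (measurable_tilted k.+1 mF F0)
    (g := fun t : R * rseq R => (t.2, translate y t.1 (unitv k)))).
  by apply: measurable_fun_pair => //; exact: measurable_translate.
have G0 F t : (forall t, 0 <= F t)%E -> (0 <= G F t)%E.
  by move=> F0; exact: tilted_ge0.
have E F : measurable_fun setT F -> (forall t, 0 <= F t)%E ->
    gint ls (fun x => tilted k F x y) z = gint ls (fun v => \int[N01]_u
        ((expR (a k * u * v k - a k ^+ 2 * v k ^+ 2 / 2 + rho k / 2 * (v k - h u) ^+ 2))%:E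
           * G F (u, v)))%E z.
  by move=> mF F0; apply: eq_gint => x; exact: tilted_step (y0 _ (leqnn k)) mF F0.
have G1 := mG _ mF1 F10; have G2 := mG _ mF2 F20.
have G10 t := G0 _ t F10; have G20 t := G0 _ t F20.
rewrite (E _ mF1 F10) (E _ mF2 F20) (CE _ G1 G10) (CE _ G2 G20).
pose z' u : rseq R := fun j => z j + cov ls j k *
  (a k * (u - a k * z k) + rho k * (z k - h u)) / (1 + S k * cov ls k k).
have mz' : measurable_fun setT z'.
  apply/measurable_fun_rseqP => i; apply: measurable_funD => //.
  apply: measurable_funM => //; apply: measurable_funM => //.
  apply: measurable_funD; apply: measurable_funM => //; exact: measurable_funB.
have mCG F : measurable_fun setT (G F) -> (forall t, 0 <= G F t)%E ->
    measurable_fun setT (fun u => (C u)%:E * gint ls' (fun v => G F (u, v)) (z' u))%E.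
  move=> mGF GF0; apply: emeasurable_funM; first exact/measurable_EFinP.
  apply: (measurableT_comp (measurable_gint_param ls' mGF GF0)
    (g := fun u : R => (u, z' u))).
  exact: measurable_fun_pair.
apply: ge0_le_integral => //.
- by move=> u _; rewrite mule_ge0 ?lee_fin// gint_ge0.
- exact: mCG.
- exact: mCG.
move=> u _; apply: lee_wpmul2l; first by rewrite lee_fin.
have g0 := gam0 kn; have Dk := gamD kn.
have A0 : 0 < 1 + a k ^+ 2 * gam k k by rewrite ltr_pwDl// mulr_ge0// sqr_ge0.
apply: (IH k.+1 ls' (z' u) (translate y u (unitv k))) => //.
- by rewrite nE addSnnS.
(* Write [h] for the filter value and [g] for [gam k k]. The definition of [h] gives
   [z k - h = - a k * g * (u - a k * h)] and [u - a k * z k = (1 + a k ^+ 2 * g) * (u - a k * h)].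
   The numerator is therefore [a k * (u - a k * h) * (1 + S k * g)]: the denominator cancels and the
   weight [rho k] disappears from the mean, because the cost is centred at the filter itself. *)
- move=> i; rewrite ltnS => ki ni.
  rewrite /z' covkk covk ?ki// (zE i) ?leqW// (zE k)//=.
  rewrite filt_base_translate// translate_unit y0// add0r /h /filt filt_base_translate// translate_unit y0// add0r.
  by move: Dk; rewrite /S => Dk; field; rewrite !gt_eqF.
- move=> i ki; rewrite translate_unit_neq; first exact: y0 (ltnW ki).
  by rewrite gtn_eqF.
- move=> i j' /andP[ki ni] /andP[kj nj].
  have ki' : (k <= i < n)%N by rewrite (ltnW ki).
  have kj' : (k <= j' < n)%N by rewrite (ltnW kj).
  rewrite covE' covkk (covk _ ki') (covk _ kj') (covE _ _ ki' kj') /pseudo_cov.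
  rewrite big_nat_recr; last by [].
  by rewrite /= opprD addrA.
Qed.

End Comparison.

(** * Laws of Gaussian vectors *)

Lemma law_exists {d d' : measure_display} {T : measurableType d}
    {T' : measurableType d'} {R : realType} (P : probability T R) (f : T -> T') :
  measurable_fun setT f ->
  exists M : probability T' R,
    (forall A, measurable A -> M A = P (f @^-1` A)) /\
    forall F : T' -> \bar R, measurable_fun setT F -> (forall x, 0 <= F x)%E ->
      (\int[M]_x F x = \int[P]_w F (f w))%E.
Proof.
move=> mf.
pose f' : {mfun T >-> T'} := HB.pack f (isMeasurableFun.Build _ _ _ _ f mf).
exists (distribution P f' : probability T' R); split => // F mF F0.
exact: (@ge0_integral_distribution _ _ _ _ _ P f' F mF F0).
Qed.

Section Laws.
Context {R : realType}.
Local Notation N01 := (normal_prob (0 : R) (1 : R)).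
Implicit Types (v l : rseq R) (ls : seq (rseq R)) (F : rseq R -> \bar R).

(** Turns the iterated integral into an integral against a genuine measure, to which uniqueness of
    measures applies; one [M] serves all starting points. *)
Lemma gint_law ls : exists M : probability (rseq R) R,
  forall F v, measurable_fun setT F -> (forall z, 0 <= F z)%E ->
    gint ls F v = (\int[M]_w F (fun i => v i + w i)%R)%E.
Proof.
have madd v : measurable_fun setT (fun w : rseq R => (fun i => v i + w i) : rseq R).
  apply/measurable_fun_rseqP => i; apply: measurable_funD => //.
  exact: measurable_coord.
elim: ls => [|l ls [M ME]].
  exists (@dirac _ (rseq R) (fun=> 0) R : probability _ R) => F v mF F0.
  rewrite integral_dirac//; last exact: (measurableT_comp mF (madd v)).
  rewrite diracT mul1e/=; congr F.
  by apply/funext => i; rewrite addr0.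
pose f (t : R * rseq R) := translate t.2 t.1 l.
have mf : measurable_fun setT f by exact: measurable_translate.
have [M' [_ M'E]] := law_exists (N01 \x M)%E mf.
exists M' => F v mF F0.
rewrite M'E//; last exact: (measurableT_comp mF (madd v)).
pose G (t : R * rseq R) := F (fun i => v i + f t i).
have mG : measurable_fun setT G.
  exact: (measurableT_comp mF (measurableT_comp (madd v) mf)).
rewrite (@fubini_tonelli1 _ _ _ _ _ N01 M G mG (fun=> F0 _)).
rewrite [LHS]/=; apply: eq_integral => x _; rewrite (ME _ _ mF F0).
apply: eq_integral => w _; congr F; apply/funext => i.
by rewrite /f /translate/=; ring.
Qed.

Definition box (n : nat) (B : nat -> set R) : set (rseq R) :=
  [set v | forall i, (i < n)%N -> B i (v i)].

Lemma measurable_box n B : (forall i, measurable (B i)) -> measurable (box n B).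
Proof.
move=> mB; rewrite (_ : box n B = \big[setI/setT]_(i < n) ((fun v => v i) @^-1` B i)).
  apply: bigsetI_measurable => i _.
  by rewrite -[X in measurable X]setTI; exact: measurable_coord.
rewrite -(bigcap_mkord n (fun i => (fun v : rseq R => v i) @^-1` B i)); apply/seteqP; split=> v /=.
  by move=> H i /= ni; exact: H.
by move=> H i ni; exact: H.
Qed.

Lemma rseq_measure_unique (M1 M2 : probability (rseq R) R) :
  (forall n B, (forall i, measurable (B i)) -> M1 (box n B) = M2 (box n B)) ->
  forall A, measurable A -> M1 A = M2 A.
Proof.
move=> H.
pose G : set (set (rseq R)) :=
  [set A | exists n B, (forall i, measurable (B i)) /\ A = box n B].
have GT : G setT by exists 0%N, (fun=> setT); split => //; apply/seteqP; split.
apply: (measure_unique G (fun=> setT)) => //.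
- apply/seteqP; split.
    apply: smallest_sub; first exact: smallest_sigma_algebra.
    move=> _ [i _] [B mB <-]; apply: sub_sigma_algebra.
    exists i.+1, (fun j => if j == i then B else setT); split.
      by move=> j; case: ifP.
    rewrite setTI; apply/seteqP; split => v /=.
      by move=> Bv j _; case: eqVneq => // ->.
    by move=> /(_ i (ltnSn i)); rewrite eqxx.
  apply: smallest_sub; first exact: sigma_algebra_measurable.
  by move=> _ [n [B [mB ->]]]; exact: measurable_box.
- move=> _ _ [n [B [mB ->]]] [k [C [mC ->]]].
  exists (maxn n k), (fun i => (if (i < n)%N then B i else setT) `&`
                               (if (i < k)%N then C i else setT)); split.
    by move=> i; apply: measurableI; case: ifP.
  apply/seteqP; split => v /=.
    by move=> [Bv Cv] i _; split; case: ifP => // ?; [exact: Bv|exact: Cv].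
  move=> H'; split => i ni.
    by have [] := H' i; rewrite ?leq_max ni// => ->.
  by have [] := H' i; rewrite ?leq_max ni ?orbT// => _ ->.
- by rewrite bigcup_const.
- by move=> A [n [B [mB ->]]]; exact: H.
- by move=> k; rewrite /= probability_setT ltry.
Qed.

Lemma gint_box (s : seq nat) (n : nat) (B : nat -> set R) v :
  (forall i, measurable (B i)) -> uniq s -> (forall i, i \in s -> (i < n)%N) ->
  (forall i, i \in s -> v i = 0) ->
  gint (map unitv s) (fun w => (\1_(box n B) w)%:E) v =
  (\prod_(i < n) (if (i : nat) \in s then N01 (B i) else (\1_(B i) (v i))%:E))%E.
Proof.
move=> mB; elim: s v => [|j s IH] v.
  move=> _ _ _ /=; have [vB|] := pselect (box n B v).
    rewrite indicE mem_set// big1// => i _.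
    by rewrite indicE mem_set//; exact: vB.
  move=> vB; rewrite indicE memNset//.
  move: vB => /existsNP[i /not_implyP[ni Bi]].
  by rewrite (bigD1 (Ordinal ni))//= indicE memNset// mul0e.
rewrite cons_uniq => /andP[js us] sn v0.
rewrite [LHS]/=.
pose C := (\prod_(i < n | i != j :> nat)
  (if (i : nat) \in s then N01 (B i) else (\1_(B i) (v i))%:E))%E.
have jn : (j < n)%N by rewrite sn// mem_head.
transitivity (\int[N01]_x ((\1_(B j) x)%:E * C))%E.
  apply: eq_integral => x _; rewrite IH//.
  - rewrite (bigD1 (Ordinal jn))//= (negbTE js) translate_unit v0 ?mem_head// add0r.
    congr (_ * _)%E; apply: eq_big => [i|i ij]; first by rewrite -val_eqE.
    by rewrite translate_unit_neq.
  - by move=> i si; rewrite sn// inE si orbT.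
  - move=> i si; rewrite translate_unit_neq ?v0 ?inE ?si ?orbT//.
    by apply: contraNneq js => <-.
rewrite ge0_integralZr; [|exact: measurableT| |by move=> x _; rewrite lee_fin|]; last 2 first.
- by apply/measurable_EFinP; apply: measurable_indic; exact: mB.
- by rewrite /C; apply: prode_ge0 => i _; case: ifP => _//; rewrite lee_fin.
have -> : (\int[N01]_x (\1_(B j) x)%:E = N01 (B j))%E.
  by rewrite integral_indic; [rewrite setIT|exact: measurableT|exact: mB].
rewrite [RHS](bigD1 (Ordinal jn))//= mem_head.
congr (_ * _)%E; apply: eq_big => [i|i ij]; first by rewrite -val_eqE.
by rewrite inE (negbTE ij).
Qed.

End Laws.

Section IID.
Context {R : realType}.
Local Notation N01 := (normal_prob (0 : R) (1 : R)).

Definition vec_of {I Omega : Type} (J : seq I) (Z : I -> Omega -> R) (w : Omega) :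
    rseq R :=
  fun i => oapp (Z^~ w) 0 (onth J i).

Lemma measurable_vec_of {I : Type} d (Omega : measurableType d) (J : seq I)
    (Z : I -> Omega -> R) :
  (forall i, measurable_fun setT (Z i)) -> measurable_fun setT (vec_of J Z).
Proof.
move=> mZ; apply/measurable_fun_rseqP => i; rewrite /vec_of.
by case: (onth J i).
Qed.

Lemma onth_index {I : eqType} (J : seq I) x : x \in J -> onth J (index x J) = Some x.
Proof.
by elim: J => //= y J IH; rewrite inE eq_sym; have [->//|_ /=] := eqVneq.
Qed.

Lemma onth_some {I : eqType} (J : seq I) i : (i < size J)%N -> uniq J ->
  exists2 x, x \in J & onth J i = Some x /\ index x J = i.
Proof.
elim: J i => //= y J IH [|i].
  by move=> _ _; exists y; rewrite ?mem_head ?eqxx.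
rewrite ltnS => iJ /andP[yJ uJ]; have [x xJ [Jx ix]] := IH i iJ uJ.
exists x; first by rewrite inE xJ orbT.
by split=> //; case: eqVneq => [yx|_]; [rewrite yx xJ in yJ|rewrite ix].
Qed.

Lemma prode_index {I : eqType} (J : seq I) (f : nat -> \bar R) : uniq J ->
  (\prod_(x <- J) f (index x J) = \prod_(i < size J) f i)%E.
Proof.
elim: J f => [|y J IH] f; first by rewrite big_nil big_ord0.
rewrite cons_uniq big_cons big_ord_recl /= eqxx => /andP[yJ uJ].
congr (_ * _)%E; rewrite -(IH (fun i => f i.+1)) //.
rewrite big_seq [RHS]big_seq; apply: eq_bigr => x xJ.
by case: eqVneq => // yx; rewrite yx xJ in yJ.
Qed.

Lemma iid_gint d (Omega : measurableType d) (P : probability Omega R)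
    (I : eqType) (D : set I) (Z : I -> {RV P >-> R}) (J : seq I) :
  iid_standard_normal D Z -> uniq J -> [set` J] `<=` D ->
  forall F : rseq R -> \bar R, measurable_fun setT F -> (forall z, 0 <= F z)%E ->
  (\int[P]_w F (vec_of J (fun i => Z i : Omega -> R) w) =
   gint (map unitv (iota 0 (size J))) F (fun=> 0%R))%E.
Proof.
move=> [indep dist] uJ JD F mF F0.
set V := vec_of J _; set ls := map unitv _; set k := size J.
have mV : measurable_fun setT V.
  by apply: measurable_vec_of => i; exact: measurable_funP.
have [M ME] := gint_law ls; have [M' [M'A M'E]] := law_exists P mV.
rewrite -M'E// ME//.
transitivity (\int[M]_w F w)%E; last first.
  by apply: eq_integral => w _; congr F; apply/funext => i; rewrite add0r.
apply: eq_measure_integral => A mA _; move: A mA.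
apply: rseq_measure_unique => n B0 mB0.
(* Padding with [setT] constrains every variable of the list, so that the product rule applies to
   the whole of [J]. *)
pose r := maxn n k; pose B i := if (i < n)%N then B0 i else setT.
have mB i : measurable (B i) by rewrite /B; case: ifP.
have -> : box n B0 = box r B.
  apply/seteqP; split=> v /= H i.
    by move=> _; rewrite /B; case: ifP => //; exact: H.
  by move=> ni; have := H i; rewrite /B ni; apply; rewrite leq_max ni.
have kr : (k <= r)%N by rewrite leq_maxr.
have mbox : measurable (box r B) by exact: measurable_box.
transitivity (\prod_(i < r) (if (i : nat) \in iota 0 k then N01 (B i)
    else (\1_(B i) (0 : R))%:E))%E; last first.
  rewrite -(@gint_box _ (iota 0 k) r B (fun=> 0))//; last 2 first.
  - exact: iota_uniq.
  - by move=> i; rewrite mem_iota add0n => /leq_trans; apply.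
  have m1 : measurable_fun setT (fun w => (\1_(box r B) w : R)%:E).
    by apply/measurable_EFinP; exact: measurable_indic.
  rewrite (ME _ _ m1); last by move=> z; rewrite lee_fin.
  rewrite (_ : (fun w => _) = (fun w => (\1_(box r B) w)%:E)); last first.
    apply/funext => w; congr (\1__ _)%:E.
    by apply/funext => i; rewrite add0r.
  by rewrite integral_indic// setIT.
rewrite M'A//.
have memE (i : nat) : (i \in iota 0 k) = (i < k)%N by rewrite mem_iota.
(* Coordinates from [k] on are the padding value 0 under both laws, so a box excluding 0 there is
   null for both. *)
have [H|] := pselect (forall i, (k <= i < r)%N -> B i 0); last first.
  move=> /existsNP[i /not_implyP[/andP[ki ir] Bi0]].
  rewrite (_ : V @^-1` _ = set0) ?measure0.
    rewrite (bigD1 (Ordinal ir))//= memE ltnNge ki/= indicE memNset//.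
    by rewrite mul0e.
  apply/seteqP; split => // w /= /(_ i ir).
  by rewrite /V /vec_of onth_default.
transitivity (\prod_(i < k) N01 (B i))%E; last first.
  rewrite -(big_mkord xpredT (fun i => if i \in iota 0 k then N01 (B i) else (\1_(B i) (0:R))%:E)).
  rewrite (@big_cat_nat _ _ _ k)//= [X in (_ * X)%E]big1_seq ?mule1.
    by rewrite big_mkord; apply: eq_bigr => i _; rewrite memE ltn_ord.
  move=> i /=; rewrite mem_index_iota => kir; rewrite memE ltnNge.
  by case/andP: (kir) => -> _ /=; rewrite indicE mem_set//; exact: H.
rewrite -(prode_index (fun i => N01 (B i)) uJ).
transitivity (\prod_(x <- J) P (Z x @^-1` B (index x J)))%E; last first.
  rewrite big_seq [RHS]big_seq; apply: eq_bigr => x xJ.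
  by rewrite -(dist x (JD _ xJ) _ (mB _)).
rewrite -indep//; congr (P _); apply/seteqP; split => w /=.
  move=> Bw x /= xJ; have := Bw (index x J).
  rewrite /V /vec_of onth_index//=; apply.
  by rewrite (leq_trans _ kr)// index_mem.
move=> Bw i ir; have [ik|ki] := ltnP i k; last first.
  by rewrite /V /vec_of onth_default//=; apply: H; rewrite ki.
have [x xJ [Jx ix]] := onth_some ik uJ.
by rewrite /V /vec_of Jx/= -ix; exact: Bw.
Qed.

Definition ext (n : nat) (f : 'I_n -> R) : rseq R := fun i => oapp f 0 (insub i).

Lemma ext_ord n (f : 'I_n -> R) (i : 'I_n) : ext f i = f i.
Proof. by rewrite /ext insubT//= => ni; congr f; exact: val_inj. Qed.

Lemma gaussian_gint d (Omega : measurableType d) (P : probability Omega R)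
    (n : nat) (X : 'I_n -> {RV P >-> R}) : gaussian_vector X ->
  exists ls v, forall F : rseq R -> \bar R,
    measurable_fun setT F -> (forall z, 0 <= F z)%E ->
    (\int[P]_w F (ext (fun i => X i w)) = gint ls F v)%E.
Proof.
case=> d2 [Om2 [P2 [k [Z [b [M0 [iid law]]]]]]].
(* The [j]-th column of the matrix, written as the linear part of [g] at the [j]-th unit vector so
   that [j] may be a natural number. *)
pose c (j : nat) := ext (fun i : 'I_n => \sum_(j' < k) M0 i j' * (j' == j :> nat)%:R).
exists (map c (iota 0 k)), (ext b) => F mF F0.
pose XT w := [tuple X i w | i < n].
pose ZT w := [tuple b i + \sum_(j < k) M0 i j * Z j w | i < n].
have mXT : measurable_fun setT XT.
  apply/measurable_fun_tnthP => i; rewrite (_ : _ \o _ = X i)//.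
  by apply/funext => w /=; rewrite tnth_mktuple.
have mZT : measurable_fun setT ZT.
  apply/measurable_fun_tnthP => i.
  rewrite (_ : _ \o _ = fun w => b i + \sum_(j < k) M0 i j * Z j w); last first.
    by apply/funext => w /=; rewrite tnth_mktuple.
  apply: measurable_funD => //; apply: measurable_sum => j.
  by apply: measurable_funM.
have [M1 [M1A M1E]] := law_exists P mXT; have [M2 [M2A M2E]] := law_exists P2 mZT.
have M12 A : measurable A -> M1 A = M2 A.
  by move=> mA; rewrite M1A// M2A//; exact: law.
pose F' (t : n.-tuple R) := F (ext (tnth t)).
have mF' : measurable_fun setT F'.
  apply: (measurableT_comp mF); apply/measurable_fun_rseqP => i.
  rewrite /ext; case: insubP => [j _ _|_] /=; last exact: measurable_cst.
  exact: measurable_tnth.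
pose g (v : rseq R) := ext (fun i : 'I_n => b i + \sum_(j < k) M0 i j * v j).
have mg : measurable_fun setT g.
  apply/measurable_fun_rseqP => i.
  rewrite /g /ext; case: insubP => [j _ _|_] /=; last exact: measurable_cst.
  apply: measurable_funD => //; apply: measurable_sum => j'.
  by apply: measurable_funM => //; exact: measurable_coord.
transitivity (\int[M1]_t F' t)%E.
  rewrite M1E//; last by move=> t; exact: F0.
  apply: eq_integral => w _; rewrite /F'; congr (F (ext _)).
  by apply/funext => i; rewrite tnth_mktuple.
transitivity (\int[M2]_t F' t)%E.
  by apply: eq_measure_integral => A mA _; exact: M12.
rewrite M2E//; last by move=> t; exact: F0.
have gE (v : rseq R) : v = (fun=> 0) -> g v = ext b.
  move=> ->; apply/funext => i; rewrite /g /ext; case: insubP => //= j _ _.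
  by rewrite big1 ?addr0// => j' _; rewrite mulr0.
transitivity (\int[P2]_w (F \o g) (vec_of (enum 'I_k) (fun i => Z i : Om2 -> R) w))%E.
  apply: eq_integral => w _; rewrite /F' /g /=; congr (F (ext _)).
  apply/funext => i; rewrite tnth_mktuple; congr (_ + _).
  apply: eq_bigr => j _; congr (_ * _).
  have -> : (j : nat) = index j (enum 'I_k) by rewrite index_enum_ord.
  by rewrite /vec_of onth_index// mem_enum.
rewrite (iid_gint iid (enum_uniq _) _ (measurableT_comp mF mg)) => [|//|z]; last exact: F0.
rewrite size_enum_ord -[ext b](gE (fun=> 0))//.
apply: gint_map => j _ z x; apply/funext => i; rewrite /g /c /translate /ext.
case: insubP => [i' _ _|_] /=; last by rewrite mulr0 addr0.
rewrite -addrA mulr_sumr -big_split/=; congr (_ + _); apply: eq_bigr => j' _.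
by rewrite /unitv; ring.
Qed.

End IID.

(** * Second moments, and identification of the mean and the covariance *)

Section Moments.
Context {R : realType}.
Local Notation N01 := (normal_prob (0 : R) (1 : R)).

Lemma integral_normal_exp_sq (s : R) : 0 < 1 - 2 * s ->
  (\int[N01]_x (expR (s * x ^+ 2))%:E = ((Num.sqrt (1 - 2 * s))^-1)%:E)%E.
Proof.
move=> D0.
have := @ge0_integral_normal_tilt R _ 0 0 (fun=> 1%E) D0.
rewrite integral_normal_cst mule1 expr0n/= mul0r addr0 expR0 mul1r => <-//.
apply: eq_integral => x _; rewrite mule1; congr (expR _)%:E.
by field.
Qed.

(* Squeezes the second moment between the Laplace transforms of the square at
   [s] and [-s], as [s] tends to [0]. *)
Lemma integral_normal_sq : (\int[N01]_x (x ^+ 2)%:E = 1)%E.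
Proof.
set I := (\int[N01]_x _)%E.
have msq : measurable_fun setT (fun x : R => (x ^+ 2)%:E).
  by apply/measurable_EFinP; exact: measurable_funX.
have mexp s : measurable_fun setT (fun x : R => (expR (s * x ^+ 2))%:E).
  apply/measurable_EFinP; apply: measurableT_comp => //.
  by apply: measurable_funM => //; exact: measurable_funX.
have I0 : (0 <= I)%E by apply: integral_ge0 => x _; rewrite lee_fin sqr_ge0.
have ubI s : 0 < s -> s <= 1 / 4 -> (I <= (1 + 4 * s)%:E)%E.
  move=> s0 s4.
  have D0 : 0 < 1 - 2 * s by lra.
  have : (1 + s%:E * I <= ((Num.sqrt (1 - 2 * s))^-1)%:E)%E.
    rewrite -(integral_normal_exp_sq D0) -ge0_integralZl//; last 2 first.
    - by move=> x _; rewrite lee_fin sqr_ge0.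
    - by rewrite lee_fin ltW.
    rewrite -[X in (X + _)%E]integral_normal_cst -ge0_integralD//; last 2 first.
    - by move=> x _; rewrite mule_ge0 ?lee_fin ?sqr_ge0// ltW.
    - exact: emeasurable_funM.
    apply: ge0_le_integral => //.
    - by move=> x _; rewrite adde_ge0// mule_ge0 ?lee_fin ?sqr_ge0// ltW.
    - by apply: emeasurable_funD => //; exact: emeasurable_funM.
    - exact: mexp.
    - by move=> x _; rewrite -EFinM -EFinD lee_fin expR_ge1Dx.
  (* The linear term must be exact, because the bound on [I] is obtained by cancelling [1] and
     dividing by [s]; the constant 4 is generous enough for all [s <= 1 / 4]. *)
  have : (Num.sqrt (1 - 2 * s))^-1 <= 1 + s + 4 * s ^+ 2.
    have q0 : 0 < Num.sqrt (1 - 2 * s) by rewrite sqrtr_gt0.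
    have q2 : Num.sqrt (1 - 2 * s) ^+ 2 = 1 - 2 * s by rewrite sqr_sqrtr// ltW.
    rewrite -[X in X <= _]div1r ler_pdivrMr//.
    have p0 : 0 <= 1 + s + 4 * s ^+ 2 by have := sqr_ge0 s; lra.
    rewrite -(@ler_pXn2r _ 2) ?nnegrE// ?mulr_ge0// ?(ltW q0)// exprMn q2 expr1n.
    have -> : (1 + s + 4 * s ^+ 2) ^+ 2 * (1 - 2 * s) =
      1 + s ^+ 2 * (5 - 10 * s - 32 * s ^+ 3) by ring.
    rewrite lerDl mulr_ge0 ?sqr_ge0//.
    have : s ^+ 3 <= (1 / 4) ^+ 3 by rewrite ler_pXn2r ?nnegrE// ltW.
    lra.
  move=> H1 H2.
  have : (1 + s%:E * I <= (1 + s + 4 * s ^+ 2)%:E)%E.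
    by apply: (le_trans H2); rewrite lee_fin.
  case: (I) I0 => [r| |]//; last by rewrite gt0_muley ?lte_fin// addey.
  rewrite !lee_fin => r0 H.
  by rewrite -(ler_pM2l s0); lra.
have lbI s : 0 < s -> s <= 1 / 4 -> ((1 - 4 * s)%:E <= I)%E.
  move=> s0 s4.
  have D0 : 0 < 1 - 2 * (- s) by lra.
  have : (1 <= ((Num.sqrt (1 - 2 * (- s)))^-1)%:E + s%:E * I)%E.
    rewrite -(integral_normal_exp_sq D0) -ge0_integralZl//; last 2 first.
    - by move=> x _; rewrite lee_fin sqr_ge0.
    - by rewrite lee_fin ltW.
    rewrite -ge0_integralD; first last.
    - by apply: emeasurable_funM => //; exact: msq.
    - by move=> x _; rewrite mule_ge0 ?lee_fin ?sqr_ge0// ltW.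
    - exact: mexp.
    - by move=> x _; rewrite lee_fin expR_ge0.
    - exact: measurableT.
    rewrite -[X in (X <= _)%E]integral_normal_cst.
    apply: ge0_le_integral => //.
    - by apply: emeasurable_funD; [exact: mexp|exact: emeasurable_funM].
    - move=> x _; rewrite -EFinM -EFinD lee_fin.
      by have := expR_ge1Dx (- s * x ^+ 2); lra.
  have : (Num.sqrt (1 - 2 * (- s)))^-1 <= 1 - s + 4 * s ^+ 2.
    have q0 : 0 < Num.sqrt (1 - 2 * (- s)) by rewrite sqrtr_gt0.
    have q2 : Num.sqrt (1 - 2 * (- s)) ^+ 2 = 1 - 2 * (- s) by rewrite sqr_sqrtr// ltW.
    rewrite -[X in X <= _]div1r ler_pdivrMr//.
    have p0 : 0 <= 1 - s + 4 * s ^+ 2 by have := sqr_ge0 s; lra.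
    rewrite -(@ler_pXn2r _ 2) ?nnegrE// ?mulr_ge0// ?(ltW q0)// exprMn q2 expr1n.
    have -> : (1 - s + 4 * s ^+ 2) ^+ 2 * (1 - 2 * - s) =
      1 + 5 * s ^+ 2 + 10 * s ^+ 3 + 32 * s ^+ 5 by ring.
    by have := exprn_ge0 2 (ltW s0); have := exprn_ge0 3 (ltW s0);
       have := exprn_ge0 5 (ltW s0); lra.
  move=> H1 H2.
  have : (1 <= (1 - s + 4 * s ^+ 2)%:E + s%:E * I)%E.
    by apply: (le_trans H2); rewrite leeD2r// lee_fin.
  case: (I) I0 => [r| |]//; last by move=> *; rewrite leey.
  rewrite !lee_fin => r0 H.
  by rewrite -(ler_pM2l s0); lra.
have s4 : 0 < 1 / 4 :> R by lra.
case: (I) I0 ubI lbI => [r| |]//; last by move=> _ /(_ _ s4 (lexx _)).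
rewrite lee_fin => r0 ub lb; congr (_%:E); apply/eqP; rewrite eq_le.
apply/andP; split; rewrite leNgt; apply/negP => r1.
  (* With [s <= (r - 1) / 8] the bound [r <= 1 + 4 * s] would give [r - 1 <= (r - 1) / 2]; the
     minimum keeps [s] in the admissible range. *)
  have := ub (Num.min (1 / 4) ((r - 1) / 8)).
  rewrite lt_min s4/= divr_gt0 ?subr_gt0// lee_fin ge_min lexx => /(_ isT isT).
  have : Num.min (1 / 4) ((r - 1) / 8) <= (r - 1) / 8 by rewrite ge_min lexx orbT.
  lra.
have := lb (Num.min (1 / 4) ((1 - r) / 8)).
rewrite lt_min s4/= divr_gt0 ?subr_gt0// lee_fin ge_min lexx => /(_ isT isT).
have : Num.min (1 / 4) ((1 - r) / 8) <= (1 - r) / 8 by rewrite ge_min lexx orbT.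
lra.
Qed.

(** Adding the integral with [b] replaced by [- b], which has the same value by symmetry, removes
    the cross term, so that only nonnegative functions are integrated. *)
Lemma integral_normal_affine_sq (a b : R) :
  (\int[N01]_x ((a + b * x) ^+ 2)%:E = (a ^+ 2 + b ^+ 2)%:E)%E.
Proof.
have mE b' : measurable_fun setT (fun x : R => ((a + b' * x) ^+ 2)%:E).
  apply/measurable_EFinP; apply: measurable_funX.
  by apply: measurable_funD => //; exact: measurable_funM.
have E0 b' x : (0 <= ((a + b' * x) ^+ 2)%:E)%E by rewrite lee_fin sqr_ge0.
have H : (\int[N01]_x ((a + b * x) ^+ 2)%:E +
          \int[N01]_x ((a + b * x) ^+ 2)%:E = (2 * (a ^+ 2 + b ^+ 2))%:E)%E.
  transitivity (\int[N01]_x ((a + b * x) ^+ 2)%:E +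
          \int[N01]_x ((a + - b * x) ^+ 2)%:E)%E.
    congr (_ + _)%E; rewrite -(ge0_integral_normal_opp (mE b) (E0 b)).
    by apply: eq_integral => x _; rewrite mulrN mulNr.
  rewrite -ge0_integralD; [|exact: measurableT|by move=> x _; exact: E0|exact: mE
    |by move=> x _; exact: E0|exact: mE].
  transitivity (\int[N01]_x ((2 * a ^+ 2)%:E + (2 * b ^+ 2)%:E * (x ^+ 2)%:E))%E.
    by apply: eq_integral => x _; rewrite -EFinM -!EFinD; congr EFin; ring.
  have msq : measurable_fun setT (fun x : R => (x ^+ 2)%:E).
    by apply/measurable_EFinP; exact: measurable_funX.
  have p0 c : 0 <= 2 * c ^+ 2 :> R by rewrite mulr_ge0 ?sqr_ge0.
  rewrite ge0_integralD; [|exact: measurableT|by move=> x _; rewrite lee_fin p0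
    |exact: measurable_cst|by move=> x _; rewrite mule_ge0// lee_fin ?sqr_ge0
    |exact: emeasurable_funM].
  rewrite integral_normal_cst ge0_integralZl; [|exact: measurableT|exact: msq
    |by move=> x _; rewrite lee_fin sqr_ge0|by rewrite lee_fin].
  by rewrite integral_normal_sq mule1 -EFinD mulrDr.
have : (0 <= \int[N01]_x ((a + b * x) ^+ 2)%:E)%E by exact: integral_ge0.
move: H; set I := (\int[N01]_x _)%E; case: I => [r| |]// [H] _.
by congr EFin; lra.
Qed.

(** The coefficients [p], [q] and [c] make one formula serve both for the means, through the choices
    of [c], and for the covariances, through squares of sums. *)
Lemma gint_sq (ls : seq (rseq R)) (i j : nat) (p q c : R) z :
  gint ls (fun v => ((p * v i + q * v j - c) ^+ 2)%:E) z =
  ((p * z i + q * z j - c) ^+ 2 + \sum_(l <- ls) (p * l i + q * l j) ^+ 2)%:E.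
Proof.
elim: ls z => [|l ls IH] z /=; first by rewrite big_nil addr0.
rewrite big_cons.
set A := p * z i + _ - c; set B := p * l i + _; set C := \sum_(_ <- _) _.
transitivity (\int[N01]_x (((A + B * x) ^+ 2)%:E + C%:E))%E.
  apply: eq_integral => x _; rewrite IH -EFinD; congr (_ ^+ 2 + _)%:E.
  by rewrite /translate /A /B; ring.
rewrite ge0_integralD//.
- by rewrite integral_normal_affine_sq integral_normal_cst -EFinD addrA.
- by move=> x _; rewrite lee_fin sqr_ge0.
- apply/measurable_EFinP; apply: measurable_funX.
  by apply: measurable_funD => //; exact: measurable_funM.
- by move=> x _; rewrite lee_fin; apply: sumr_ge0 => l' _; exact: sqr_ge0.
Qed.

End Moments.

Section GaussianMoments.
Context {R : realType} {d : measure_display} {Omega : measurableType d}.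
Variable P : probability Omega R.
Variables (X : nat -> {RV P >-> R}) (m : nat -> R) (K : nat -> nat -> R).
Hypothesis X_mean : forall t, (1 <= t)%N -> ('E_P[X t] = (m t)%:E)%E.
Hypothesis X_cov : forall t s, (1 <= t)%N -> (1 <= s)%N ->
  covariance P (X t) (X s) = (K t s)%:E.

Let C (t : nat) (w : Omega) : R := X t.+1 w - m t.+1.

Let mC t : measurable_fun setT (C t).
Proof. by apply: measurable_funB => //; exact: measurable_funP. Qed.

Let covE t s : (\int[P]_w (C t w * C s w)%:E = (K t.+1 s.+1)%:E)%E.
Proof.
rewrite -X_cov// covariance.unlock !X_mean// expectation.unlock.
by apply: eq_integral => w _.
Qed.

(** All integrability comes from here: the integral of a nonnegative square is the finite number
    [K t.+1 t.+1]. Products and [C t] itself are then dominated. *)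
Let integrable_sq t : P.-integrable setT (fun w => (C t w * C t w)%:E).
Proof.
apply/integrableP; split.
  by apply/measurable_EFinP; exact: measurable_funM.
under eq_integral do rewrite gee0_abs ?lee_fin -?expr2 ?sqr_ge0// expr2.
by rewrite covE ltry.
Qed.

Let integrable_mul t s : P.-integrable setT (fun w => (C t w * C s w)%:E).
Proof.
apply: (le_integrable measurableT _ _ (integrableD measurableT (integrable_sq t) (integrable_sq s))).
  by apply/measurable_EFinP; exact: measurable_funM.
move=> w _ /=; rewrite lee_fin.
rewrite normrM [X in _ <= X]ger0_norm ?addr_ge0// -?expr2 ?sqr_ge0//.
rewrite -(real_normK (num_real (C t w))) -(real_normK (num_real (C s w))).
by have := sqr_ge0 (`|C t w| - `|C s w|); have := normr_ge0 (C t w);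
  have := normr_ge0 (C s w); nra.
Qed.

Let integrable_C t : P.-integrable setT (fun w => (C t w)%:E).
Proof.
have i1 : P.-integrable setT (fun=> 1%:E : \bar R) by exact: finite_measure_integrable_cst.
apply: (le_integrable measurableT _ _ (integrableD measurableT (integrable_sq t) i1)).
  exact/measurable_EFinP.
move=> w _ /=; rewrite lee_fin.
rewrite [X in _ <= X]ger0_norm ?addr_ge0// -?expr2 ?sqr_ge0//.
rewrite -(real_normK (num_real (C t w))).
by have := sqr_ge0 (`|C t w| - 1); have := normr_ge0 (C t w); nra.
Qed.

Let integral_C t : (\int[P]_w (C t w)%:E = 0)%E.
Proof.
have im : P.-integrable setT (fun=> (m t.+1)%:E : \bar R).
  exact: finite_measure_integrable_cst.
have := X_mean (ltn0Sn t); rewrite unlock.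
have -> : (\int[P]_w (X t.+1 w)%:E = \int[P]_w ((C t w)%:E + (m t.+1)%:E))%E.
  by apply: eq_integral => w _; rewrite -EFinD /C subrK.
rewrite integralD//= (_ : \int[P]_w (m t.+1)%:E = (m t.+1)%:E)%E; last first.
  by rewrite integral_cst//= -[RHS]mule1; congr (_ * _)%E; exact: probability_setT.
have : (\int[P]_w (C t w)%:E \is a fin_num)%E by exact: integrable_fin_num.
move: (\int[P]_w (C t w)%:E)%E => [r| |]// _; rewrite -EFinD => -[] H.
by congr EFin; lra.
Qed.

Variables (n : nat) (ls : seq (rseq R)) (v : rseq R).
Hypothesis law : forall F : rseq R -> \bar R,
  measurable_fun setT F -> (forall z, 0 <= F z)%E ->
  (\int[P]_w F (ext (fun i : 'I_n => X i.+1 w)) = gint ls F v)%E.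

Let sqE i j (p q c : R) : (i < n)%N -> (j < n)%N ->
  (\int[P]_w ((p * C i w + q * C j w - c) ^+ 2)%:E =
  ((p * (v i - m i.+1) + q * (v j - m j.+1) - c) ^+ 2 +
     \sum_(l <- ls) (p * l i + q * l j) ^+ 2)%:E)%E.
Proof.
move=> ni nj.
have := gint_sq ls i j p q (c + p * m i.+1 + q * m j.+1) v.
rewrite -law; last 2 first.
- apply/measurable_EFinP; apply: measurable_funX; apply: measurable_funB => //.
  by apply: measurable_funD; apply: measurable_funM => //; exact: measurable_coord.
- by move=> z; rewrite lee_fin sqr_ge0.
have -> : p * v i + q * v j - (c + p * m i.+1 + q * m j.+1) =
  p * (v i - m i.+1) + q * (v j - m j.+1) - c by ring.
move=> <-; apply: eq_integral => w _.
have -> := ext_ord (fun i : 'I_n => X i.+1 w) (Ordinal ni).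
have -> := ext_ord (fun i : 'I_n => X i.+1 w) (Ordinal nj).
by rewrite /C /=; congr (_ ^+ 2)%:E; ring.
Qed.

(* Compares the expectations of [C i ^ 2] and [(C i - 1) ^ 2]. *)
Lemma gaussian_mean i : (i < n)%N -> v i = m i.+1.
Proof.
move=> ni.
have := sqE 1 0 0 ni ni; have := sqE 1 0 1 ni ni.
rewrite !mul1r !mul0r !addr0 !subr0.
have -> : (\int[P]_w ((1 * C i w + 0 * C i w - 0) ^+ 2)%:E = (K i.+1 i.+1)%:E)%E.
  by rewrite -covE; apply: eq_integral => w _; congr EFin; ring.
have -> : (\int[P]_w ((1 * C i w + 0 * C i w - 1) ^+ 2)%:E = (K i.+1 i.+1 + 1)%:E)%E.
  have i1 : P.-integrable setT (fun=> 1%:E : \bar R).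
    exact: finite_measure_integrable_cst.
  transitivity (\int[P]_w ((C i w * C i w)%:E + 1%:E + (- 2)%:E * (C i w)%:E))%E.
    by apply: eq_integral => w _; rewrite -EFinM -!EFinD; congr EFin; ring.
  have i2 := integrableD measurableT (integrable_mul i i) i1.
  have i3 := integrableZl measurableT (- 2) (integrable_C i).
  rewrite (integralD measurableT i2 i3) (integralD measurableT (integrable_mul i i) i1).
  rewrite (integralZl measurableT (integrable_C i)) integral_C mule0 adde0 covE EFinD.
  congr (_ + _)%E; rewrite integral_cst//= -[RHS]mule1.
  by congr (_ * _)%E; exact: probability_setT.
move=> [H1] [H2]; move: H1 H2; set S := \sum_(_ <- _) _; lra.
Qed.

(** Polarisation: the squares of [C i], [C j] and their sum, being nonnegative, are within reach of
    [law], and they determine the mixed moment. *)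
Lemma gaussian_cov i j : (i < n)%N -> (j < n)%N -> cov ls i j = K i.+1 j.+1.
Proof.
move=> ni nj.
have covii k : (k < n)%N -> \sum_(l <- ls) l k ^+ 2 = K k.+1 k.+1.
  move=> nk; have := sqE 1 0 0 nk nk.
  rewrite (gaussian_mean nk) subrr !mulr0 !addr0 subrr expr0n/= add0r.
  have -> : (\int[P]_w ((1 * C k w + 0 * C k w - 0) ^+ 2)%:E = (K k.+1 k.+1)%:E)%E.
    by rewrite -covE; apply: eq_integral => w _; congr EFin; ring.
  by case=> ->; apply: eq_bigr => l _; congr (_ ^+ 2); ring.
have := sqE 1 1 0 ni nj.
rewrite (gaussian_mean ni) (gaussian_mean nj) !subrr !mulr0 !addr0 subrr expr0n/= add0r.
have -> : (\int[P]_w ((1 * C i w + 1 * C j w - 0) ^+ 2)%:E =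
    (K i.+1 i.+1 + 2 * K i.+1 j.+1 + K j.+1 j.+1)%:E)%E.
  transitivity (\int[P]_w ((C i w * C i w)%:E + 2%:E * (C i w * C j w)%:E +
    (C j w * C j w)%:E))%E.
    by apply: eq_integral => w _; rewrite -EFinM -!EFinD; congr EFin; ring.
  have i2 := integrableZl measurableT 2 (integrable_mul i j).
  have i3 := integrableD measurableT (integrable_mul i i) i2.
  rewrite (integralD measurableT i3 (integrable_mul j j)).
  rewrite (integralD measurableT (integrable_mul i i) i2).
  by rewrite (integralZl measurableT (integrable_mul i j)) !covE.
have -> : \sum_(l <- ls) (1 * l i + 1 * l j) ^+ 2 =
    \sum_(l <- ls) l i ^+ 2 + 2 * cov ls i j + \sum_(l <- ls) l j ^+ 2.
  by rewrite /cov mulr_sumr -!big_split; apply: eq_bigr => l _ /=; ring.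
by rewrite !covii// => -[]; lra.
Qed.

End GaussianMoments.

(** * Conditional comparison and factorisation *)

Section Enumeration.
Context {R : realType}.

Definition nth_rat (n : nat) : R := ratr (odflt 0%R (unpickle n : option rat)).

Lemma nth_rat_itv (a b : R) : a < b -> exists n, a < nth_rat n < b.
Proof.
move=> /rat_in_itvoo[q]; rewrite in_itv/= => qab.
by exists (pickle q); rewrite /nth_rat pickleK.
Qed.

Lemma ereal_separated (x y : \bar R) : (x < y)%E ->
  exists i j, [/\ nth_rat i < nth_rat j, (x <= (nth_rat i)%:E)%E
    & ((nth_rat j)%:E <= y)%E].
Proof.
move=> xy; have [a [b [ab xa bY]]] : exists a b, [/\ a < b, (x <= a%:E)%E & (b%:E <= y)%E].
  move: x y xy => [x| |] [y| |] //.
  - by rewrite lte_fin => xy; exists x, y.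
  - by exists x, (x + 1); rewrite ltrDl leey.
  - by exists (y - 1), y; rewrite gtrBl leNye.
  - by exists 0, 1; rewrite leNye leey.
have [i /andP[ai ib]] := nth_rat_itv ab; have [j /andP[ij jb]] := nth_rat_itv ib.
exists i, j; split => //.
- by rewrite (le_trans xa)// lee_fin ltW.
- by rewrite (le_trans _ bY)// lee_fin ltW.
Qed.

End Enumeration.

Section ConditionalComparison.
Context {R : realType} {d : measure_display} {Omega : measurableType d}.
Variable P : probability Omega R.

(** Versions of a conditional expectation are only known to be measurable, so the positive and the
    negative parts are compared separately, infinite integrals included. *)
Lemma monotone_integral (D : set Omega) (f g : Omega -> \bar R) : measurable D ->
  measurable_fun D f -> measurable_fun D g -> (forall x, D x -> f x <= g x)%E ->
  (\int[P]_(x in D) f x <= \int[P]_(x in D) g x)%E.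
Proof.
move=> mD mf mg fg; rewrite integralE [leRHS]integralE; apply: leeB.
- apply: ge0_le_integral => //; try exact: measurable_funepos.
  by move=> x Dx; apply: (@funepos_le _ _ D) => [y /set_mem Dy|]; [exact: fg|exact: mem_set].
- apply: ge0_le_integral => //; try exact: measurable_funeneg.
  by move=> x Dx; apply: (@funeneg_le _ _ D) => [y /set_mem Dy|]; [exact: fg|exact: mem_set].
Qed.

Variable G : set (set Omega).
Hypothesis sG : sigma_algebra setT G.
Hypothesis Gm : forall A, G A -> measurable A.

Lemma measurable_wrt_measurable {d'} {T' : measurableType d'} (f : Omega -> T') :
  measurable_wrt G f -> measurable_fun setT f.
Proof. by move=> Gf _ B mB; rewrite setTI; apply: Gm; exact: Gf. Qed.

Lemma sigma_algebra_setI A B : G A -> G B -> G (A `&` B).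
Proof.
move=> GA GB.
have H : <<s G >> A /\ <<s G >> B by split; exact: sub_sigma_algebra.
suff : <<s G >> (A `&` B) by rewrite sigma_algebra_id.
case: H => HA HB.
exact: (@measurableI _ (g_sigma_algebraType G) A B HA HB).
Qed.

(** Where [e1] exceeds [e2], two rationals [q < r] satisfy [e2 <= q] and [r <= e1]. The set [A] of
    such points for a given pair is in [G], and integrating over it gives [r * P A <= q * P A],
    hence [P A = 0]; there are countably many pairs. No difference [e1 - e2] is formed, as both may
    be infinite. *)
Lemma ae_le_of_integral (e1 e2 : Omega -> \bar R) :
  measurable_wrt G e1 -> measurable_wrt G e2 ->
  (forall A, G A -> (\int[P]_(w in A) e1 w <= \int[P]_(w in A) e2 w)%E) ->
  {ae P, forall w, (e1 w <= e2 w)%E}.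
Proof.
move=> G1 G2 H.
have m1 := measurable_wrt_measurable G1; have m2 := measurable_wrt_measurable G2.
pose bad i j w := (e2 w <= (nth_rat i : R)%:E)%E /\ ((nth_rat j : R)%:E <= e1 w)%E.
suff : forall i j, nth_rat i < nth_rat j :> R -> {ae P, forall w, ~ bad i j w}.
  move=> ae_bad.
  have : {ae P, forall w, forall i j, nth_rat i < nth_rat j :> R -> ~ bad i j w}.
    apply: ae_foralln => i; apply: ae_foralln => j.
    have [ij|ij] := pselect (nth_rat i < nth_rat j :> R).
      by apply: filterS (ae_bad i j ij) => w.
    by apply: filterS filterT => w _ /ij.
  apply: filterS => w Hw; rewrite leNgt; apply/negP => /ereal_separated[i [j [ij ei ej]]].
  by apply: (Hw i j ij).
move=> i j ij.
pose A := [set w | bad i j w].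
have GA : G A.
  apply: sigma_algebra_setI.
    have := G2 _ (@emeasurable_itv R `]-oo, (nth_rat i)%:E]%O).
    by congr G; apply/seteqP; split => w /=; rewrite in_itv.
  have := G1 _ (@emeasurable_itv R `[(nth_rat j)%:E, +oo[%O).
  by congr G; apply/seteqP; split => w /=; rewrite in_itv/= andbT.
have mA := Gm GA.
have PA0 : P A = 0%E.
  have : ((nth_rat j)%:E * P A <= (nth_rat i)%:E * P A)%E.
    rewrite -!integral_cst//.
    apply: (@le_trans _ _ (\int[P]_(w in A) e1 w)%E).
      apply: monotone_integral => //; first exact: measurable_funTS.
      by move=> w [].
    apply: (le_trans (H _ GA)).
    apply: monotone_integral => //; first exact: measurable_funTS.
    by move=> w [].
  have : P A \is a fin_num by exact: fin_num_measure.
  have : (0 <= P A)%E by exact: measure_ge0.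
  case: (P A) => [r| |]//; rewrite !lee_fin => r0 _ Hr; congr EFin; apply/eqP; rewrite eq_le r0 andbT leNgt.
  by apply/negP => r1; move: Hr; rewrite ler_pM2r// leNgt ij.
have /negligibleP : P A = 0%E by [].
move=> /(_ mA) [B [mB PB AB]]; exists B; split => //.
by move=> w /= /contrapT Aw; exact: AB.
Qed.

End ConditionalComparison.

Section Generated.
Context {R : realType} {d : measure_display} {Omega : measurableType d}.

Lemma rseq_preimage (G : set (set Omega)) (V : Omega -> rseq R) :
  sigma_algebra setT G ->
  (forall i B, measurable B -> G ((fun w => V w i) @^-1` B)) ->
  forall A, measurable A -> G (V @^-1` A).
Proof.
move=> [G0 GC GU] GV.
suff : @measurable _ (rseq R) `<=` [set A | G (V @^-1` A)] by [].
apply: smallest_sub.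
  split => /=.
  - by rewrite preimage_set0.
  - by move=> B GB; rewrite setTD -preimage_setC -setTD; exact: GC.
  - by move=> F GF; rewrite preimage_bigcup; exact: GU.
by move=> _ [i _] [B mB <-] /=; rewrite setTI; exact: GV.
Qed.

Lemma sigma_of_preimage (I : Type) (D : set I) (Y : I -> Omega -> R)
    (V : Omega -> rseq R) :
  (forall u, D u -> exists k, forall w, Y u w = V w k) ->
  forall A, sigma_of D Y A -> exists B, measurable B /\ A = V @^-1` B.
Proof.
move=> YV.
suff : sigma_of D Y `<=` [set A | exists B, measurable B /\ A = V @^-1` B] by [].
apply: smallest_sub.
  split => /=.
  - by exists set0; split => //; rewrite preimage_set0.
  - move=> _ [B [mB ->]]; exists (~` B); split; first exact: measurableC.
    by rewrite setTD preimage_setC.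
  - move=> F /choice[B HB].
    exists (\bigcup_i B i); split; first by apply: bigcup_measurable => i _; have [] := HB i.
    by rewrite preimage_bigcup; apply: eq_bigcup => // i _; have [] := HB i.
move=> _ [u Du] [B mB <-]; have [k Vk] := YV u Du.
exists ((fun v : rseq R => v k) @^-1` B); split.
  by rewrite -[X in measurable X]setTI; exact: measurable_coord.
by rewrite setTI; apply/seteqP; split => w /=; rewrite Vk.
Qed.

(** [g w] is the infimum of the rationals above it, and each event that [g] is below a given
    rational is the preimage under [V] of some [B n]. The infimum of the rationals whose [B n]
    contains [y] therefore defines [h y]; off the range of [V] it may be infinite, and [fine] then
    supplies a real value. *)
Lemma doob_dynkin (V : Omega -> rseq R) (g : Omega -> R) :
  (forall B : set R, measurable B -> exists C, measurable C /\ g @^-1` B = V @^-1` C) ->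
  exists2 h : rseq R -> R, measurable_fun setT h & forall w, g w = h (V w).
Proof.
move=> gV.
have /choice[B HB] : forall n, exists C, measurable C /\
    g @^-1` [set x | x < nth_rat n] = V @^-1` C.
  move=> n; apply: gV.
  have := @measurable_itv R `]-oo, (nth_rat n : R)[.
  by congr measurable; apply/seteqP; split => x /=; rewrite in_itv.
pose f n (y : rseq R) : \bar R := if y \in B n then (nth_rat n)%:E else +oo%E.
have mf n : measurable_fun setT (f n).
  apply: measurable_fun_if => //.
  apply: (measurable_fun_bool true).
  rewrite setTI (_ : _ @^-1` _ = B n); first by have [] := HB n.
  by apply/seteqP; split => y /=; [exact: set_mem|exact: mem_set].
exists (fun y => fine (einfs (f ^~ y) 0%N)).
  by apply: measurableT_comp => //; exact: measurable_fun_einfs.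
move=> w; suff -> : einfs (f ^~ (V w)) 0%N = (g w)%:E by [].
have memE n : (V w \in B n) = (g w < nth_rat n).
  have [_ /seteqP[H1 H2]] := HB n.
  apply/idP/idP; first by rewrite inE => /H2.
  by move=> gw; rewrite inE; exact: H1.
apply/eqP; rewrite eq_le; apply/andP; split.
  apply/lee_addgt0Pr => e e0.
  have [n /andP[gn ne]] : exists n, g w < nth_rat n < g w + e.
    by apply: nth_rat_itv; rewrite ltrDl.
  apply: (@le_trans _ _ (f n (V w))).
    by apply: ereal_inf_lbound; exists n.
  by rewrite /f memE gn -EFinD lee_fin ltW.
apply: le_ereal_inf_tmp => _ [n _ <-]; rewrite /f memE.
by case: ifPn => gn; rewrite ?leey// lee_fin ltW.
Qed.

End Generated.

(** * Law of the observations *)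

Lemma ge0_integral_independent {R : realType} {d d1 d2 : measure_display}
    {Omega : measurableType d} {T1 : measurableType d1} {T2 : measurableType d2}
    (P : probability Omega R) (U : Omega -> T1) (V : Omega -> T2) :
  measurable_fun setT U -> measurable_fun setT V ->
  (forall A B, measurable A -> measurable B ->
     P (U @^-1` A `&` V @^-1` B) = (P (U @^-1` A) * P (V @^-1` B))%E) ->
  forall F : T1 * T2 -> \bar R, measurable_fun setT F -> (forall t, 0 <= F t)%E ->
  (\int[P]_w F (U w, V w) = \int[P]_w \int[P]_w' F (U w, V w'))%E.
Proof.
move=> mU mV indep F mF F0.
have mUV : measurable_fun setT (fun w => (U w, V w)) by exact: measurable_fun_pair.
have [M1 [M1A M1E]] := law_exists P mU; have [M2 [M2A M2E]] := law_exists P mV.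
have [M [MA ME]] := law_exists P mUV.
rewrite -ME//.
transitivity (\int[M1 \x M2]_t F t)%E.
  apply: eq_measure_integral => X mX _; apply/esym.
  apply: (@product_measure_unique _ _ _ _ _ M1 M2 M _ X mX) => A B mA mB.
  apply: (etrans (MA _ (measurableX mA mB))); apply: (etrans (indep A B mA mB)).
  by congr (_ * _)%E; apply/esym; [exact: M1A|exact: M2A].
rewrite (@fubini_tonelli1 _ _ _ _ _ M1 M2 F mF F0).
rewrite M1E; last 2 first.
- exact: (@measurable_fun_fubini_tonelli_F _ _ _ _ _ M2 F).
- by move=> x; apply: integral_ge0 => y _; exact: F0.
apply: eq_integral => w _; rewrite /fubini_F M2E//.
exact: measurableT_comp.
Qed.

Section Girsanov.
Context {R : realType}.
Local Notation N01 := (normal_prob (0 : R) (1 : R)).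

(** With the state frozen, the drift [b] is deterministic, and the formula is one Cameron-Martin
    shift per coordinate. Starting at 0 on [s] makes each coordinate its own integration
    variable. *)
Lemma gint_girsanov (s : seq nat) (b : rseq R) (F : rseq R -> \bar R) (v : rseq R) :
  uniq s -> (forall i, i \in s -> v i = 0) ->
  measurable_fun setT F -> (forall z, 0 <= F z)%E ->
  gint (map unitv s) (fun e => F (fun i => (if i \in s then b i else 0) + e i)) v =
  gint (map unitv s)
    (fun y => (expR (\sum_(i <- s) (b i * y i - b i ^+ 2 / 2)))%:E * F y)%E v.
Proof.
elim: s F v => [|j s IH] F v.
  move=> _ _ mF F0 /=; rewrite big_nil expR0 mul1e; congr F.
  by apply/funext => i; rewrite add0r.
rewrite cons_uniq => /andP[js us] v0 mF F0.
have mbj : measurable_fun setT (fun y : rseq R => translate y (b j) (unitv j)).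
  exact: measurable_translate.
pose G (y : rseq R) := ((expR (\sum_(i <- s) (b i * y i - b i ^+ 2 / 2)))%:E * F y)%E.
have mE (s' : seq nat) :
    measurable_fun setT (fun y : rseq R => (expR (\sum_(i <- s') (b i * y i - b i ^+ 2 / 2)))%:E).
  apply/measurable_EFinP; apply: measurableT_comp => //.
  apply: measurable_sum => i; apply: measurable_funB => //.
  by apply: measurable_funM => //; exact: measurable_coord.
have mG : measurable_fun setT G by exact: emeasurable_funM.
have G0 y : (0 <= G y)%E by rewrite mule_ge0// lee_fin expR_ge0.
pose k x := gint (map unitv s) G (translate v x (unitv j)).
have mk : measurable_fun setT k by exact: measurable_gint_translate.
transitivity (\int[N01]_x k (b j + x)%R)%E.
  rewrite [LHS]/=; apply: eq_integral => x _.
  have := IH (fun y => F (translate y (b j) (unitv j))) (translate v x (unitv j)) us.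
  have -> : (fun e : rseq R => F (translate (fun i => (if i \in s then b i else 0) + e i) (b j) (unitv j))) =
            (fun e => F (fun i => (if i \in j :: s then b i else 0) + e i)).
    apply/funext => e; congr F; apply/funext => i.
    rewrite inE /translate /unitv; have [->|ij] := eqVneq i j; last by rewrite mulr0 addr0.
    by rewrite (negbTE js) mulr1 add0r addrC.
  move=> -> //.
  - rewrite /k.
    have -> : translate v (b j + x) (unitv j) = translate (translate v x (unitv j)) (b j) (unitv j).
      by apply/funext => i; rewrite /translate; ring.
    rewrite -(@gint_map _ _ s unitv unitv (fun y => translate y (b j) (unitv j))); last first.
      by move=> i _ z y; rewrite translateC.
    apply: eq_gint => y; rewrite /G /=; congr ((expR _)%:E * _)%E.
    rewrite big_seq [RHS]big_seq; apply: eq_bigr => i si.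
    by rewrite translate_unit_neq//; apply: contraNneq js => <-.
  - move=> i si; rewrite translate_unit_neq ?v0// ?inE ?si ?orbT//.
    by apply: contraNneq js => <-.
  - exact: measurableT_comp.
rewrite ge0_integral_normal_shift//; last by move=> x; exact: gint_ge0.
rewrite [RHS]/=; apply: eq_integral => x _; rewrite /k.
pose w (y : rseq R) := (expR (b j * y j - b j ^+ 2 / 2))%:E.
transitivity (gint (map unitv s) (fun y => w y * G y)%E (translate v x (unitv j))).
  rewrite gint_pull//.
  - by rewrite /w translate_unit v0 ?mem_head// add0r.
  - by move=> y; rewrite lee_fin expR_ge0.
  - move=> l /mapP[i si ->] y u; rewrite /w translate_unit_neq//.
    by apply: contraNneq js => ->.
by apply: eq_gint => y; rewrite big_cons expRD EFinM -muleA.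
Qed.

End Girsanov.

Section ObservationLaw.
Context {R : realType} {d : measure_display} {Omega : measurableType d}.
Variables (P : probability Omega R) (X eps : nat -> {RV P >-> R}) (n : nat).
Variable a : rseq R.
Hypothesis eps_iid : iid_standard_normal [set t : nat | (1 <= t)%N] eps.
Hypothesis X_eps_indep : independent_classes P
  (sigma_of [set t : nat | (1 <= t)%N] (fun t => X t : Omega -> R))
  (sigma_of [set t : nat | (1 <= t)%N] (fun t => eps t : Omega -> R)).

Definition Xvec (w : Omega) : rseq R := ext (fun i : 'I_n => X i.+1 w).

Definition Evec (w : Omega) : rseq R :=
  vec_of (iota 1 n) (fun t => eps t : Omega -> R) w.

Definition obs (x e : rseq R) : rseq R := fun i => (if (i < n)%N then a i * x i else 0) + e i.

Definition Yvec (w : Omega) : rseq R := obs (Xvec w) (Evec w).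

Lemma Xvec_coord i w : (i < n)%N -> Xvec w i = X i.+1 w.
Proof. by move=> ni; exact: (ext_ord (fun i : 'I_n => X i.+1 w) (Ordinal ni)). Qed.

Lemma Evec_coord i w : (i < n)%N -> Evec w i = eps i.+1 w.
Proof.
move=> ni; rewrite /Evec /vec_of.
suff -> : forall m k j, (j < k)%N -> onth (iota m k) j = Some (m + j)%N by [].
move=> m k; elim: k m => [|k IH] m [|j] //=; first by rewrite addn0.
by rewrite ltnS => /IH ->; rewrite addSnnS.
Qed.

Lemma Evec_default i w : (n <= i)%N -> Evec w i = 0.
Proof. by move=> ni; rewrite /Evec /vec_of onth_default ?size_iota. Qed.

Lemma Xvec_default i w : (n <= i)%N -> Xvec w i = 0.
Proof. by move=> ni; rewrite /Xvec /ext insubF// ltnNge ni. Qed.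

Lemma Yvec_coord i w : (i < n)%N ->
  Yvec w i = a i * X i.+1 w + eps i.+1 w.
Proof. by move=> ni; rewrite /Yvec /obs ni Xvec_coord// Evec_coord. Qed.

Lemma measurable_Evec : measurable_fun setT Evec.
Proof. by apply: measurable_vec_of => i; exact: measurable_funP. Qed.

Lemma measurable_Xvec : measurable_fun setT Xvec.
Proof.
apply/measurable_fun_rseqP => i; have [ni|ni] := ltnP i n.
  by under eq_fun do rewrite Xvec_coord//; exact: measurable_funP.
by under eq_fun do rewrite Xvec_default//; exact: measurable_cst.
Qed.

Lemma measurable_obs :
  measurable_fun setT (fun t : rseq R * rseq R => obs t.1 t.2).
Proof.
apply/measurable_fun_rseqP => i; apply: measurable_funD; last first.
  exact: (measurableT_comp (measurable_coord i) measurable_snd).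
case: (i < n)%N; last exact: measurable_cst.
apply: measurable_funM => //.
exact: (measurableT_comp (measurable_coord i) measurable_fst).
Qed.

Let sigma_coord (Z : nat -> {RV P >-> R}) (V : Omega -> rseq R) :
  (forall i w, (i < n)%N -> V w i = Z i.+1 w) -> (forall i w, (n <= i)%N -> V w i = 0) ->
  forall A, measurable A ->
    sigma_of [set t : nat | (1 <= t)%N] (fun t => Z t : Omega -> R) (V @^-1` A).
Proof.
move=> VZ V0.
have sG : sigma_algebra setT
    (sigma_of [set t : nat | (1 <= t)%N] (fun t => Z t : Omega -> R)).
  exact: smallest_sigma_algebra.
have [G0 GC _] := sG.
apply: rseq_preimage => //.
move=> i B mB; have [ni|ni] := ltnP i n.
  apply: sub_sigma_algebra; exists i.+1 => //; exists B => //.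
  by rewrite setTI; apply/seteqP; split => w /=; rewrite VZ.
have [B0|B0] := pselect (B 0).
  rewrite (_ : _ @^-1` _ = setT); last first.
    by apply/seteqP; split => w //= _; rewrite V0.
  rewrite -[setT]setC0 -setTD; exact: GC.
rewrite (_ : _ @^-1` _ = set0) //.
by apply/seteqP; split => w //=; rewrite V0.
Qed.

Variables (ls : seq (rseq R)) (v : rseq R).
Hypothesis law : forall F : rseq R -> \bar R,
  measurable_fun setT F -> (forall z, 0 <= F z)%E ->
  (\int[P]_w F (Xvec w) = gint ls F v)%E.

Lemma observation_gint (H : rseq R * rseq R -> \bar R) :
  measurable_fun setT H -> (forall t, 0 <= H t)%E ->
  (\int[P]_w H (Xvec w, Yvec w))%E =
  gint ls (fun x => gint (map unitv (iota 0 n)) (fun y =>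
    (expR (\sum_(0 <= i < n) (a i * y i * x i - a i ^+ 2 * x i ^+ 2 / 2)))%:E
      * H (x, y))%E (fun=> 0)) v.
Proof.
move=> mH H0.
pose F (t : rseq R * rseq R) := H (t.1, obs t.1 t.2).
have mF : measurable_fun setT F.
  apply: (measurableT_comp mH); apply: measurable_fun_pair => //.
  exact: measurable_obs.
have F0 t : (0 <= F t)%E by exact: H0.
rewrite (@ge0_integral_independent _ _ _ _ _ _ _ P Xvec Evec
  measurable_Xvec measurable_Evec _ F mF F0); last first.
  move=> A B mA mB; apply: X_eps_indep.
    by apply: sigma_coord => //; [exact: Xvec_coord|exact: Xvec_default].
  by apply: sigma_coord => //; [exact: Evec_coord|exact: Evec_default].
pose L x := gint (map unitv (iota 0 n)) (fun e => F (x, e)) (fun=> 0).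
transitivity (\int[P]_w L (Xvec w))%E.
  apply: eq_integral => w _; rewrite /L.
  have := iid_gint eps_iid (iota_uniq 1 n) _ (F := fun e => F (Xvec w, e)).
  rewrite size_iota => <- //.
  - by move=> t /=; rewrite mem_iota => /andP[].
  - exact: measurableT_comp.
rewrite law; last 2 first.
- apply: (measurableT_comp (measurable_gint_param (map unitv (iota 0 n)) mF F0)
    (g := fun x : rseq R => (x, (fun=> 0) : rseq R))).
  exact: measurable_fun_pair.
- by move=> x; exact: gint_ge0.
apply: eq_gint => x; rewrite /L.
transitivity (gint (map unitv (iota 0 n)) (fun e => H (x, (fun i =>
  (if i \in iota 0 n then a i * x i else 0) + e i))) (fun=> 0)).
  apply: eq_gint => e; rewrite /F /=; congr (H (_, _)).
  by apply/funext => i; rewrite /obs mem_iota.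
rewrite (@gint_girsanov _ _ (fun i => a i * x i) (fun y => H (x, y)))//.
- apply: eq_gint => y; congr ((expR _)%:E * _)%E.
  rewrite /index_iota subn0; apply: eq_bigr => i _.
  by rewrite exprMn mulrAC.
- exact: iota_uniq.
- exact: measurableT_comp.
Qed.

End ObservationLaw.

(** * The risk-sensitive filter *)

Section Reduction.
Context {R : realType}.
Implicit Types (ls : seq (rseq R)) (z y : rseq R).

Lemma filt_baseE (m : rseq R) (gam : nat -> nat -> R) (a : rseq R) k y i :
  filt_base m gam a k y i =
  m i + \sum_(0 <= s < k) gam i s * a s * (y s - a s * filt m gam a s y).
Proof.
elim: k => [|k IH] /=; first by rewrite big_geq// addr0.
by rewrite big_nat_recr//= IH addrA.
Qed.

(** The filter equation is implicit, its last term containing the unknown, and [filt] is the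
    solution obtained by division. Adding the contribution of observation [k] to the base thus
    returns the filter. *)
Lemma filt_base_filt (m : rseq R) (gam : nat -> nat -> R) (a : rseq R) k y :
  1 + a k ^+ 2 * gam k k != 0 ->
  filt_base m gam a k.+1 y k = filt m gam a k y.
Proof. by move=> D0 /=; rewrite /filt; field. Qed.

End Reduction.

Section RiskSensitive.
Context {R : realType} {d : measure_display} {Omega : measurableType d}.
Variables (P : probability Omega R) (X eps : nat -> {RV P >-> R}).
Variables (m : nat -> R) (K : nat -> nat -> R) (A Q : nat -> R) (mu : R).
Hypothesis X_gaussian : gaussian_sequence X.
Hypothesis X_mean : forall t : nat, (1 <= t)%N -> ('E_P[X t] = (m t)%:E)%E.
Hypothesis X_cov : forall t s : nat, (1 <= t)%N -> (1 <= s)%N ->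
  covariance P (X t) (X s) = (K t s)%:E.
Hypothesis eps_iid : iid_standard_normal [set t : nat | (1 <= t)%N] eps.
Hypothesis X_eps_indep : independent_classes P
  (sigma_of [set t : nat | (1 <= t)%N] (fun t => X t : Omega -> R))
  (sigma_of [set t : nat | (1 <= t)%N] (fun t => eps t : Omega -> R)).
Hypothesis Q_ge0 : forall t : nat, (1 <= t)%N -> 0 <= Q t.
Variables (T : nat) (gam : nat -> nat -> R).
Hypothesis C_mu : condition_C K A Q mu T gam.
Variable n : nat.
Hypothesis nT : (1 <= n <= T)%N.

Let a : rseq R := fun i => A i.+1.
Let gam0 i j := gam i.+1 j.+1.
Let m0 : rseq R := fun i => m i.+1.
(* No cost is attached to the last instant, whose weight depends on the
   competitor. *)
Let rho : rseq R := fun s => if (s < n.-1)%N then mu * Q s.+1 else 0.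
Let Xv := Xvec X n.
Let Yv := Yvec X eps n a.
Let flt s y := filt m0 gam0 a s y.

Let Xv_coord i w : (i < n)%N -> Xv w i = X i.+1 w.
Proof. by move=> ni; rewrite /Xv Xvec_coord. Qed.

Let n0 : (0 < n)%N. Proof. by case/andP: nT. Qed.

Let gam_ge0 s : (s < n)%N -> 0 <= gam0 s s.
Proof.
move=> sn; case: C_mu => _ _ _ H.
by have [] := H s.+1; rewrite //= (leq_trans sn)//; case/andP: nT.
Qed.

Let A_neq0 s : (s < n)%N -> 1 + a s ^+ 2 * gam0 s s != 0.
Proof.
move=> sn; rewrite gt_eqF// ltr_pwDl// mulr_ge0 ?sqr_ge0//.
exact: gam_ge0.
Qed.

(** Before the last instant this is part of [C_mu]; at the last one [rho] is 0 and the sign of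
    [gam0] suffices. *)
Let gamD s : (s < n)%N -> 0 < 1 + (a s ^+ 2 - rho s) * gam0 s s.
Proof.
move=> sn; rewrite /rho; case: ifPn => _; last first.
  by rewrite subr0 ltr_pwDl// mulr_ge0 ?sqr_ge0// gam_ge0.
case: C_mu => _ _ _ H.
by have [] := H s.+1; rewrite //= (leq_trans sn)//; case/andP: nT.
Qed.

(** Setting the last weight to 0 does not affect the recursion: its sum runs over indices below
    [s <= n.-1], where [rho] is the true weight. *)
Let gamE i s : (s <= i < n)%N ->
  gam0 i s = pseudo_cov (fun i j => K i.+1 j.+1) gam0 a rho s i s.
Proof.
move=> /andP[si ni]; case: C_mu => H _ _ _.
have iT : (i < T)%N by rewrite (leq_trans ni)//; case/andP: nT.
have [_ gE] := H i.+1 s.+1 isT si iT.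
rewrite -[LHS]/(gam i.+1 s.+1) gE.
rewrite /pseudo_cov; congr (_ - _).
rewrite big_add1 /= big_nat_cond [RHS]big_nat_cond; apply: eq_bigr => l /andP[/andP[_ ls] _].
suff -> : a l ^+ 2 - rho l = S_coef A Q mu l.+1 by [].
rewrite /rho /S_coef ifT//.
by rewrite (leq_trans ls)// (leq_trans si)// -ltnS prednK.
Qed.

Let measurable_flt s : measurable_fun setT (flt s).
Proof. exact: measurable_filt. Qed.

(** The cost stripped of its factor [mu], hence nonnegative, for the competitor [f] and with the
    event as an indicator, so that everything is a function of the state and of the observations. *)
Definition weighted (k : R) (B : set (rseq R)) (f : rseq R -> R) (w : Omega) : \bar R :=
  (\1_B (Yv w) * expR (k * (X n w - f (Yv w)) ^+ 2 +
     \sum_(0 <= s < n) rho s / 2 * (X s.+1 w - flt s (Yv w)) ^+ 2))%:E.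

Let final k (B : set (rseq R)) (f : rseq R -> R) (t : rseq R * rseq R) : \bar R :=
  ((\1_B t.2)%:E * (expR (k * (t.1 n.-1 - f t.2) ^+ 2))%:E)%E.

Let measurable_final k B f : measurable B -> measurable_fun setT f ->
  measurable_fun setT (final k B f).
Proof.
move=> mB mf; apply: emeasurable_funM.
  apply/measurable_EFinP; apply: (measurableT_comp (measurable_indic mB)).
  exact: measurable_snd.
apply/measurable_EFinP; apply: measurableT_comp => //.
apply: measurable_funM => //; apply: measurable_funX; apply: measurable_funB.
  exact: (measurableT_comp (measurable_coord n.-1) measurable_fst).
exact: (measurableT_comp mf measurable_snd).
Qed.

Let final_ge0 k B f t : (0 <= final k B f t)%E.
Proof. by rewrite mule_ge0// lee_fin ?expR_ge0. Qed.

Let integral_weighted k B f ls v : measurable B -> measurable_fun setT f ->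
  (forall F : rseq R -> \bar R,
     measurable_fun setT F -> (forall z, 0 <= F z)%E ->
     (\int[P]_w F (Xv w) = gint ls F v)%E) ->
  (\int[P]_w weighted k B f w)%E =
  gint ls (fun x => gint (units n 0) (fun y =>
    (expR (tilt n m0 gam0 a rho 0 x y))%:E * final k B f (x, y))%E (fun=> 0)) v.
Proof.
move=> mB mf law.
pose c (t : rseq R * rseq R) := \sum_(0 <= s < n) rho s / 2 * (t.1 s - flt s t.2) ^+ 2.
have mc : measurable_fun setT c.
  apply: measurable_sum => s; apply: measurable_funM => //; apply: measurable_funX.
  apply: measurable_funB.
    exact: (measurableT_comp (measurable_coord s) measurable_fst).
  exact: (measurableT_comp (measurable_flt s) measurable_snd).
pose H t := ((expR (c t))%:E * final k B f t)%E.
have mH : measurable_fun setT H.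
  apply: emeasurable_funM; last exact: measurable_final.
  by apply/measurable_EFinP; exact: measurableT_comp.
have H0 t : (0 <= H t)%E by rewrite mule_ge0// lee_fin expR_ge0.
transitivity (\int[P]_w H (Xv w, Yv w))%E.
  apply: eq_integral => w _; rewrite /H /final /weighted /c /=.
  rewrite Xv_coord ?prednK// -!EFinM; congr EFin.
  rewrite expRD [RHS]mulrC -[RHS]mulrA; congr (_ * (_ * expR _)).
  rewrite big_nat_cond [RHS]big_nat_cond; apply: eq_bigr => s /andP[/andP[_ sn] _].
  by rewrite Xv_coord.
rewrite (observation_gint a eps_iid X_eps_indep law mH H0).
apply: eq_gint => x; rewrite /units subn0; apply: eq_gint => y.
rewrite /H muleA -EFinM -expRD /tilt /c -big_split /=.
by [].
Qed.

(** Once all observations are fixed, the indicator of [B] and the competitors are constants; the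
    hypothesis compares these under Gaussian laws whose last coordinate is centred at the filter. *)
Lemma weighted_le (k : R) (B : set (rseq R)) (f1 f2 : rseq R -> R) : measurable B ->
  measurable_fun setT f1 -> measurable_fun setT f2 ->
  (forall (ls : seq (rseq R)) z y, z n.-1 = flt n.-1 y ->
    (gint ls (fun x => (expR (k * (x n.-1 - f1 y) ^+ 2))%:E) z <=
     gint ls (fun x => (expR (k * (x n.-1 - f2 y) ^+ 2))%:E) z)%E) ->
  (\int[P]_w weighted k B f1 w <= \int[P]_w weighted k B f2 w)%E.
Proof.
move=> mB mf1 mf2 H.
have [ls [v law]] := gaussian_gint (X_gaussian n).
have mean := gaussian_mean X_mean X_cov law.
have covE := gaussian_cov X_mean X_cov law.
rewrite (integral_weighted _ mB mf1 law) (integral_weighted _ mB mf2 law).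
have mE (f : rseq R -> R) y : measurable_fun setT (fun x : rseq R => (expR (k * (x n.-1 - f y) ^+ 2))%:E).
  apply/measurable_EFinP; apply: measurableT_comp => //.
  apply: measurable_funM => //; apply: measurable_funX.
  by apply: measurable_funB => //; exact: measurable_coord.
have E0 (f : rseq R -> R) y (x : rseq R) : (0 <= (expR (k * (x n.-1 - f y) ^+ 2))%:E)%E.
  by rewrite lee_fin expR_ge0.
have finalE ls' z (f : rseq R -> R) y : gint ls' (fun x => final k B f (x, y)) z =
    ((\1_B y)%:E * gint ls' (fun x => (expR (k * (x n.-1 - f y) ^+ 2))%:E) z)%E.
  apply: (@gint_pull _ ls' (fun=> (\1_B y)%:E) _ z (mE f y) (E0 f y)); last by [].
  by move=> z'; rewrite lee_fin.
apply: (@tilted_le R n m0 (fun i j => K i.+1 j.+1) gam0 a rho n0 gamE gam_ge0 gamD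
  (final k B f1) (final k B f2)) => //.
- exact: measurable_final.
- exact: measurable_final.
- move=> ls' z y zE; rewrite !finalE; apply: lee_wpmul2l; first by rewrite lee_fin.
  apply: H; rewrite zE -[in filt_base _ _ _ n](prednK n0) filt_base_filt//.
  by apply: A_neq0; rewrite prednK.
- by move=> i _ ni /=; rewrite mean.
- by move=> i j /andP[_ ni] /andP[_ nj]; rewrite covE// /pseudo_cov big_geq// subr0.
Qed.

Variable h : nat -> Omega -> R.
Local Notation Y := (observation A (fun t => X t : Omega -> R) (fun t => eps t : Omega -> R)).
Hypothesis h_eq : filter_equation m A gam Y T h.

Let Y_coord i w : (i < n)%N -> Yv w i = Y i.+1 w.
Proof. by move=> ni; rewrite /Yv Yvec_coord. Qed.

(** Strong induction turns the earlier terms of the sum into [filt_base]; what is left is a linear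
    equation in [h s.+1 w] with nonzero leading coefficient. *)
Lemma filter_flt s w : (s < n)%N -> h s.+1 w = flt s (Yv w).
Proof.
elim/ltn_ind: s => s IH sn.
have := h_eq w (t := s.+1).
have -> : (1 <= s.+1 <= T)%N.
  by rewrite /= (leq_trans sn)//; case/andP: nT.
move=> /(_ isT); rewrite big_add1 /= big_nat_recr//=.
rewrite (_ : \sum_(0 <= i < s) _ =
    \sum_(0 <= i < s) gam0 s i * a i * (Yv w i - a i * flt i (Yv w))); last first.
  rewrite big_nat_cond [RHS]big_nat_cond; apply: eq_bigr => i /andP[/andP[_ si] _].
  have ni := ltn_trans si sn.
  by rewrite (IH i si ni) (Y_coord _ ni) (mulrC (gam0 _ _)).
rewrite addrA -[m s.+1]/(m0 s) -filt_baseE -Y_coord//.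
rewrite -/(a s) -/(gam0 s s) /flt /filt => H.
have D0 := A_neq0 sn.
apply: (mulIf D0); rewrite divfK//.
set z := filt_base _ _ _ _ _ _ in H *.
move: H; set hs := h _ _; set ys := Yv w s; lra.
Qed.

Let Yt := sigma_of [set u : nat | (1 <= u <= n)%N] Y.

Let measurable_Y u : measurable_fun setT (Y u).
Proof.
by apply: measurable_funD; [apply: measurable_funM|]; rewrite ?measurable_funPT.
Qed.

Let measurable_Yv : measurable_fun setT Yv.
Proof.
apply: (measurableT_comp (measurable_obs n a) (g := fun w => (Xv w, Evec eps n w))).
by apply: measurable_fun_pair; [exact: measurable_Xvec|exact: measurable_Evec].
Qed.

Let sigma_Yt : sigma_algebra setT Yt.
Proof. exact: smallest_sigma_algebra. Qed.

Let Yt_measurable B : Yt B -> measurable B.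
Proof.
move: B; suff : Yt `<=` measurable by [].
apply: smallest_sub; first exact: sigma_algebra_measurable.
by move=> _ [u _] [B mB <-]; exact: measurable_Y.
Qed.

Let Yt_Yv B : measurable B -> Yt (Yv @^-1` B).
Proof.
apply: rseq_preimage => // i C mC; have [ni|ni] := ltnP i n.
  apply: sub_sigma_algebra; exists i.+1 => //; exists C => //.
  by rewrite setTI; apply/seteqP; split => w /=; rewrite Y_coord.
have Yv0 w : Yv w i = 0.
  by rewrite /Yv /Yvec /obs ltnNge ni/= Evec_default// addr0.
have [Yt0 YtC _] := sigma_Yt.
have [C0|C0] := pselect (C 0).
  rewrite (_ : _ @^-1` _ = setT); last first.
    by apply/seteqP; split => w //= _; rewrite Yv0.
  by rewrite -[setT]setC0 -setTD; exact: YtC.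
by rewrite (_ : _ @^-1` _ = set0) //; apply/seteqP; split => w //=; rewrite Yv0.
Qed.

Let Yt_preimage B : Yt B -> exists C, measurable C /\ B = Yv @^-1` C.
Proof.
apply: sigma_of_preimage => u /= /andP[u1 un]; exists u.-1 => w.
by rewrite Y_coord prednK.
Qed.

Let measurable_weighted k B f : measurable B -> measurable_fun setT f ->
  measurable_fun setT (weighted k B f).
Proof.
move=> mB mf; apply/measurable_EFinP; apply: measurable_funM.
  exact: (measurableT_comp (measurable_indic mB) measurable_Yv).
apply: measurableT_comp => //; apply: measurable_funD.
  apply: measurable_funM => //; apply: measurable_funX; apply: measurable_funB => //.
  exact: (measurableT_comp mf measurable_Yv).
apply: measurable_sum => s; apply: measurable_funM => //; apply: measurable_funX.
apply: measurable_funB => //.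
exact: (measurableT_comp (measurable_flt s) measurable_Yv).
Qed.

Let weighted_ge0 k B f w : (0 <= weighted k B f w)%E.
Proof. by rewrite lee_fin mulr_ge0// expR_ge0. Qed.

Let integral_RS_cost B (f : rseq R -> R) (g : Omega -> R) :
  measurable B -> measurable_fun setT f -> (forall w, g w = f (Yv w)) ->
  (\int[P]_(w in Yv @^-1` B) (EFin \o RS_cost mu Q (fun t => X t : Omega -> R) h n g) w =
   mu%:E * \int[P]_w weighted (mu / 2 * Q n) B f w)%E.
Proof.
move=> mB mf gf; set W := weighted _ B f.
have mW : measurable_fun setT W by exact: measurable_weighted.
have W0 w : (0 <= W w)%E by exact: weighted_ge0.
rewrite integral_mkcond.
transitivity (\int[P]_w (mu%:E * W w))%E; last first.
  (* For [mu < 0] the integrand is nonpositive, so the sign is taken out before the nonnegative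
     factor [- mu]. *)
  have [mu0|mu0] := leP 0 mu; first by rewrite ge0_integralZl.
  transitivity (\int[P]_w - ((- mu)%:E * W w))%E.
    by apply: eq_integral => w _; rewrite EFinN mulNe oppeK.
  rewrite integral_ge0N; last first.
    by move=> w _; rewrite mule_ge0// lee_fin oppr_ge0 ltW.
  rewrite ge0_integralZl//; last by rewrite lee_fin oppr_ge0 ltW.
  by rewrite EFinN mulNe oppeK.
apply: eq_integral => w _; rewrite patchE /W /weighted indicE.
have -> : (w \in Yv @^-1` B) = (Yv w \in B) by apply/idP/idP; rewrite !inE.
case: (Yv w \in B); last by rewrite mul0r mule0.
rewrite mul1r -EFinM; congr EFin; rewrite /RS_cost; congr (_ * expR _).
rewrite gf mulrAC; congr (_ + _).
(* The summand of the last index vanishes with its weight, which leaves the past costs. *)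
rewrite -[in RHS](prednK n0) big_nat_recr//= {2}/rho ltnn mul0r mul0r addr0.
rewrite -[in LHS](prednK n0) big_add1/= mulr_sumr.
apply: eq_big_nat => s /andP[_ sn].
rewrite /rho sn filter_flt; first by ring.
by rewrite (leq_trans sn)// leq_pred.
Qed.

Lemma RS_argmin_filter : RS_argmin P mu Q (fun t => X t : Omega -> R) Y h n.
Proof.
have hE w : h n w = flt n.-1 (Yv w) by rewrite -filter_flt prednK.
split.
  move=> B mB; rewrite (_ : _ @^-1` _ = Yv @^-1` (flt n.-1 @^-1` B)).
    by apply: Yt_Yv; rewrite -[X in measurable X]setTI; exact: measurable_flt.
  by apply/seteqP; split => w /=; rewrite hE.
move=> g Ytg eh eg [Yteh intE] [Yteg intEg].
have [f mf gf] : exists2 f : rseq R -> R, measurable_fun setT f & forall w, g w = f (Yv w).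
  by apply: doob_dynkin => B mB; apply: Yt_preimage; exact: Ytg.
apply: (ae_le_of_integral sigma_Yt Yt_measurable Yteh Yteg) => B YtB.
rewrite (intE _ YtB) (intEg _ YtB); have [C [mC ->]] := Yt_preimage YtB.
rewrite (integral_RS_cost mC (measurable_flt n.-1) hE) (integral_RS_cost mC mf gf).
have Qn : 0 <= Q n by exact: Q_ge0.
(* For [mu > 0] the expected exponential is to be minimised. For [mu < 0] the factor reverses the
   order, and the filter has to maximise it: the two candidates exchange roles in [weighted_le]. *)
have [mu0|mu0|mu0] := ltgtP 0 mu; last by rewrite -mu0 !mul0e.
  apply: lee_wpmul2l; first by rewrite lee_fin ltW.
  apply: weighted_le => // ls z y zE; rewrite -zE; apply: gint_exp_sq_min.
  by rewrite mulr_ge0// divr_ge0// ltW.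
rewrite -leeN2 -!mulNe -EFinN; apply: lee_wpmul2l; first by rewrite lee_fin oppr_ge0 ltW.
apply: weighted_le => // ls z y zE; rewrite -zE; apply: gint_exp_sq_max.
by rewrite mulr_le0_ge0// pmulr_lle0// ltW.
Qed.

End RiskSensitive.

Theorem theorem4 (R : realType) (d : measure_display)
    (Omega : measurableType d) (P : probability Omega R)
    (X eps : nat -> {RV P >-> R})
    (m : nat -> R) (K : nat -> nat -> R) (A Q : nat -> R) (mu : R)
    (X_gaussian : gaussian_sequence X)
    (X_mean : forall t : nat, (1 <= t)%N -> ('E_P[X t] = (m t)%:E)%E)
    (X_cov : forall t s : nat, (1 <= t)%N -> (1 <= s)%N ->
       covariance P (X t) (X s) = (K t s)%:E)
    (eps_iid : iid_standard_normal [set t : nat | (1 <= t)%N] eps)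
    (X_eps_indep : independent_classes P
       (sigma_of [set t : nat | (1 <= t)%N] (fun t => X t : Omega -> R))
       (sigma_of [set t : nat | (1 <= t)%N] (fun t => eps t : Omega -> R)))
    (Q_ge0 : forall t : nat, (1 <= t)%N -> 0 <= Q t)
    (T : nat) (T_ge1 : (1 <= T)%N)
    (gam : nat -> nat -> R) (C_mu : condition_C K A Q mu T gam)
    (h : nat -> Omega -> R)
    (h_eq : filter_equation m A gam
       (observation A (fun t => X t : Omega -> R) (fun t => eps t : Omega -> R))
       T h) :
  forall t : nat, (1 <= t <= T)%N ->
    RS_argmin P mu Q (fun t => X t : Omega -> R)
      (observation A (fun t => X t : Omega -> R) (fun t => eps t : Omega -> R))
      h t.
Proof.
move=> t tT.
exact: (RS_argmin_filter X_gaussian X_mean X_cov eps_iid X_eps_indep Q_ge0 C_mu tT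
  h_eq).
Qed.
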